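(* Consider the two-user state-dependent discrete memoryless multiple-access channel (MAC) with cooperating encoders and three independent states described in the context, with finite alphabets $\mathcal X_1,\mathcal X_2,\mathcal S_0,\mathcal S_1,\mathcal S_2,\mathcal Y$, state laws $P_{S_0},P_{S_1},P_{S_2}$ and channel law $P_{Y|X_1X_2S_0S_1S_2}$, where $(S_0^n,S_1^n)$ is known non-causally to encoder 1 and $(S_0^n,S_2^n)$ is known non-causally to encoder 2. Then the following rate region is achievable: the union, over all finite alphabets $\mathcal U,\mathcal V_1,\mathcal V_2$ and all joint distributions of random variables $(S_0,S_1,S_2,U,V_1,V_2,X_1,X_2,Y)$ (with $U,V_1,V_2$ taking values in $\mathcal U,\mathcal V_1,\mathcal V_2$) of the form $$P(s_0,s_1,s_2,u,v_1,v_2,x_1,x_2,y)=P_{S_0}(s_0)P_{S_1}(s_1)P_{S_2}(s_2)\,P_{U|S_0}(u|s_0)\,P_{X_1V_1|US_0S_1}(x_1,v_1|u,s_0,s_1)\,P_{X_2V_2|US_0S_2}(x_2,v_2|u,s_0,s_2)\,P_{Y|X_1X_2S_0S_1S_2}(y|x_1,x_2,s_0,s_1,s_2),$$ of the sets of pairs $(R_1,R_2)$ with $R_1,R_2\ge0$ and $$R_1\le I(X_1;V_1|U,S_0)-I(V_1;S_1|U,S_0),$$ $$R_2\le I(X_2;V_2|U,S_0)-I(V_2;S_2|U,S_0),$$ $$R_1+R_2\le I(Y;V_1,V_2,U)-I(U,V_1,V_2;S_0,S_1,S_2).$$ That is, every such pair $(R_1,R_2)$ belongs to the capacity region (the closure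 of the set of achievable rate pairs).
   Context: Channel model. The channel and states are memoryless: $P(y^n|x_1^n,x_2^n,s_0^n,s_1^n,s_2^n)=\prod_{i=1}^nP_{Y|X_1X_2S_0S_1S_2}(y_i|x_{1i},x_{2i},s_{0i},s_{1i},s_{2i})$ and $P(s_0^n,s_1^n,s_2^n)=\prod_{i=1}^nP_{S_0}(s_{0i})P_{S_1}(s_{1i})P_{S_2}(s_{2i})$. Codes. Encoder $i\in\{1,2\}$ has a message $W_i$ uniform on $\mathcal W_i=\{1,\dots,2^{nR_i}\}$ ($2^{nR_i}$ rounded down to an integer if necessary); $W_1$, $W_2$, $S_0^n$, $S_1^n$, $S_2^n$ are mutually independent. A length-$n$ code of rates $(R_1,R_2)$ consists of encoding functions $$f_{1,j}:\mathcal W_1\times\mathcal S_0^n\times\mathcal S_1^n\times\mathcal X_2^{j-1}\to\mathcal X_1,\qquad f_{2,j}:\mathcal W_2\times\mathcal S_0^n\times\mathcal S_2^n\times\mathcal X_1^{j-1}\to\mathcal X_2,\qquad j=1,\dots,n,$$ and a decoding function $g:\mathcal Y^n\to\mathcal W_1\times\mathcal W_2$. The transmitted symbols are $X_{1,j}=f_{1,j}(W_1,S_0^n,S_1^n,X_2^{j-1})$ and $X_{2,j}=f_{2,j}(W_2,S_0^n,S_2^n,X_1^{j-1})$, i.e. each encoder knows its states non-causally and observes the other encoder's past transmitted symbols noiselessly and strictly causally (this is what ''cooperating encoders'' means). The decoder outputs $(\hat W_1,\hat W_2)=g(Y^n)$. The average error probability is $$P_e^n=2^{-n(R_1+R_2)}\sum_{w_1,w_2}\Pr\{(\hat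 W_1,\hat W_2)\ne(w_1,w_2)\mid (w_1,w_2)\text{ sent}\}.$$ A pair $(R_1,R_2)$ is achievable if there is a sequence of length-$n$ codes of rates $(R_1,R_2)$ with $P_e^n\to0$ as $n\to\infty$; the capacity region is the closure of the set of achievable pairs. Mutual informations are in bits. *)

(* Defs.v *)
From HB Require Import structures.
From mathcomp Require Import all_boot all_order all_algebra.
From mathcomp Require Import all_classical all_reals all_analysis.

Set Implicit Arguments.
Unset Strict Implicit.
Unset Printing Implicit Defensive.

Import Order.TTheory GRing.Theory Num.Theory.
Import numFieldNormedType.Exports.

Local Open Scope classical_set_scope.
Local Open Scope ring_scope.

Section Information.
Context {R : realType}.

Definition is_pmf (T : finType) (p : T -> R) : Prop :=
  (forall x, 0 <= p x) /\ \sum_(x : T) p x = 1.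

Definition log2 (x : R) : R := ln x / ln 2.

(* Random variables are functions on a finite sample space [Om] carrying the
   probability mass function [p]. *)
Definition law (Om T : finType) (p : Om -> R) (A : Om -> T) (a : T) : R :=
  \sum_(w : Om | A w == a) p w.

(* In both sums below a term whose leading probability vanishes is 0, i.e. the
   usual convention 0 log 0 = 0; otherwise no denominator vanishes. *)
Definition mutual_info (Om TA TB : finType) (p : Om -> R)
    (A : Om -> TA) (B : Om -> TB) : R :=
  \sum_(a : TA) \sum_(b : TB)
    law p (fun w => (A w, B w)) (a, b) *
    log2 (law p (fun w => (A w, B w)) (a, b) / (law p A a * law p B b)).

(* I(A;B|C), with p(a,b|c) / (p(a|c) p(b|c)) = p(a,b,c) p(c) / (p(a,c) p(b,c)) *)
Definition cond_mutual_info (Om TA TB TC : finType) (p : Om -> R)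
    (A : Om -> TA) (B : Om -> TB) (C : Om -> TC) : R :=
  \sum_(a : TA) \sum_(b : TB) \sum_(c : TC)
    law p (fun w => (A w, B w, C w)) (a, b, c) *
    log2 (law p (fun w => (A w, B w, C w)) (a, b, c) * law p C c /
          (law p (fun w => (A w, C w)) (a, c) *
           law p (fun w => (B w, C w)) (b, c))).

End Information.

Section Codes.
Context {R : realType} {X1 X2 S0 S1 S2 Y : finType}.

(* Positions are numbered from 0, so the encoder at position [j] has seen the [j]
   previous symbols of the other encoder. The encoding functions at positions
   [j >= n] are never used. *)
Record mac_code (n M1 M2 : nat) := MacCode {
  enc1 : forall j : nat,
    'I_M1 -> n.-tuple S0 -> n.-tuple S1 -> j.-tuple X2 -> X1;
  enc2 : forall j : nat,
    'I_M2 -> n.-tuple S0 -> n.-tuple S2 -> j.-tuple X1 -> X2;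
  dec : n.-tuple Y -> 'I_M1 * 'I_M2 }.

Fixpoint transmitted (n M1 M2 : nat) (c : mac_code n M1 M2) (w1 : 'I_M1) (w2 : 'I_M2)
    (s0 : n.-tuple S0) (s1 : n.-tuple S1) (s2 : n.-tuple S2) (j : nat) :
    j.-tuple X1 * j.-tuple X2 :=
  match j with
  | 0 => ([tuple], [tuple])
  | j'.+1 =>
      let: (x1, x2) := transmitted c w1 w2 s0 s1 s2 j' in
      ([tuple of rcons x1 (enc1 c w1 s0 s1 x2)],
       [tuple of rcons x2 (enc2 c w2 s0 s2 x1)])
  end.

Context (PS0 : S0 -> R) (PS1 : S1 -> R) (PS2 : S2 -> R).
(* [W x1 x2 s0 s1 s2 y] is P(y | x1, x2, s0, s1, s2). *)
Context (W : X1 -> X2 -> S0 -> S1 -> S2 -> Y -> R).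

Definition state_prob (n : nat)
    (s0 : n.-tuple S0) (s1 : n.-tuple S1) (s2 : n.-tuple S2) : R :=
  \prod_(i < n) (PS0 (tnth s0 i) * PS1 (tnth s1 i) * PS2 (tnth s2 i)).

Definition channel_prob (n : nat) (x1 : n.-tuple X1) (x2 : n.-tuple X2)
    (s0 : n.-tuple S0) (s1 : n.-tuple S1) (s2 : n.-tuple S2)
    (y : n.-tuple Y) : R :=
  \prod_(i < n)
    W (tnth x1 i) (tnth x2 i) (tnth s0 i) (tnth s1 i) (tnth s2 i) (tnth y i).

Definition cond_error_prob (n M1 M2 : nat) (c : mac_code n M1 M2)
    (w1 : 'I_M1) (w2 : 'I_M2) : R :=
  \sum_(s0 : n.-tuple S0) \sum_(s1 : n.-tuple S1) \sum_(s2 : n.-tuple S2)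
    state_prob s0 s1 s2 *
    (let: (x1, x2) := transmitted c w1 w2 s0 s1 s2 n in
     \sum_(y : n.-tuple Y | dec c y != (w1, w2))
       channel_prob x1 x2 s0 s1 s2 y).

(* [1/(M1 M2)] is 2^(-n(R1+R2)) once the sizes 2^(nRi) are rounded down. *)
Definition avg_error_prob (n M1 M2 : nat) (c : mac_code n M1 M2) : R :=
  (M1 * M2)%:R^-1 *
  \sum_(w1 : 'I_M1) \sum_(w2 : 'I_M2) cond_error_prob c w1 w2.

Definition nb_messages (n : nat) (r : R) : nat := Num.truncn (2 `^ (n%:R * r)).

(* A negative rate would make the message set empty for large [n]. *)
Definition achievable (r : R * R) : Prop :=
  [/\ 0 <= r.1, 0 <= r.2 &
   exists c : forall n, mac_code n (nb_messages n r.1) (nb_messages n r.2),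
     avg_error_prob (c n) @[n --> \oo] --> (0 : R)].

Definition capacity_region : set (R * R) := closure [set r | achievable r].

End Codes.

Section Region.
Context {R : realType} {X1 X2 S0 S1 S2 Y : finType}.
Context (PS0 : S0 -> R) (PS1 : S1 -> R) (PS2 : S2 -> R).
Context (W : X1 -> X2 -> S0 -> S1 -> S2 -> Y -> R).

Section Auxiliaries.
Context {U V1 V2 : finType}.

Definition outcome : finType := (S0 * S1 * S2 * U * V1 * V2 * X1 * X2 * Y)%type.

Definition rv_S0 (w : outcome) : S0 := let: (s0, _, _, _, _, _, _, _, _) := w in s0.
Definition rv_S1 (w : outcome) : S1 := let: (_, s1, _, _, _, _, _, _, _) := w in s1.
Definition rv_S2 (w : outcome) : S2 := let: (_, _, s2, _, _, _, _, _, _) := w in s2.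
Definition rv_U (w : outcome) : U := let: (_, _, _, u, _, _, _, _, _) := w in u.
Definition rv_V1 (w : outcome) : V1 := let: (_, _, _, _, v1, _, _, _, _) := w in v1.
Definition rv_V2 (w : outcome) : V2 := let: (_, _, _, _, _, v2, _, _, _) := w in v2.
Definition rv_X1 (w : outcome) : X1 := let: (_, _, _, _, _, _, x1, _, _) := w in x1.
Definition rv_X2 (w : outcome) : X2 := let: (_, _, _, _, _, _, _, x2, _) := w in x2.
Definition rv_Y (w : outcome) : Y := let: (_, _, _, _, _, _, _, _, y) := w in y.

Definition joint_law (PU : S0 -> U -> R) (PX1V1 : U -> S0 -> S1 -> X1 * V1 -> R)
    (PX2V2 : U -> S0 -> S2 -> X2 * V2 -> R) (w : outcome) : R :=
  let: (s0, s1, s2, u, v1, v2, x1, x2, y) := w in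
  PS0 s0 * PS1 s1 * PS2 s2 * PU s0 u * PX1V1 u s0 s1 (x1, v1) *
  PX2V2 u s0 s2 (x2, v2) * W x1 x2 s0 s1 s2 y.

Definition rate_constraints (p : outcome -> R) (r : R * R) : Prop :=
  let US0 w := (rv_U w, rv_S0 w) in
  [/\ r.1 <= cond_mutual_info p rv_X1 rv_V1 US0 -
             cond_mutual_info p rv_V1 rv_S1 US0,
      r.2 <= cond_mutual_info p rv_X2 rv_V2 US0 -
             cond_mutual_info p rv_V2 rv_S2 US0 &
      r.1 + r.2 <=
        mutual_info p rv_Y (fun w => (rv_V1 w, rv_V2 w, rv_U w)) -
        mutual_info p (fun w => (rv_U w, rv_V1 w, rv_V2 w))
                      (fun w => (rv_S0 w, rv_S1 w, rv_S2 w))].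

End Auxiliaries.

Definition rate_region : set (R * R) :=
  [set r | [/\ 0 <= r.1, 0 <= r.2 &
    exists (U V1 V2 : finType) (PU : S0 -> U -> R)
      (PX1V1 : U -> S0 -> S1 -> X1 * V1 -> R)
      (PX2V2 : U -> S0 -> S2 -> X2 * V2 -> R),
    [/\ forall s0, is_pmf (PU s0),
        forall u s0 s1, is_pmf (PX1V1 u s0 s1),
        forall u s0 s2, is_pmf (PX2V2 u s0 s2) &
        rate_constraints (joint_law PU PX1V1 PX2V2) r]]].

End Region.

(* Main.v *)
Require Import Defs.
From mathcomp Require Import all_boot all_order all_algebra.
From mathcomp Require Import all_classical all_reals all_analysis.
From mathcomp Require Import ring lra.
Import Order.TTheory GRing.Theory Num.Theory.
Import numFieldNormedType.Exports.
Local Open Scope classical_set_scope.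
Local Open Scope ring_scope.

Set Implicit Arguments.
Unset Strict Implicit.
Unset Printing Implicit Defensive.

(* Block-Markov coding with backward decoding. At the start of a block both
   encoders know the message pair [k] of the previous block and the common state,
   hence agree on [u]; [v1] and [v2] carry the fresh messages, which each encoder
   learns from the symbols of the other one by the end of the block. The receiver
   processes the blocks backwards, so it knows the fresh pair [m] of a block when
   it recovers [k] from [u], [v1], [v2].

   Inside a block, the codebooks are random subsets of the spaces of sequences
   [u], [v1], [v2], which keep each sequence with probability [q0], [q1], [q2].
   An encoder draws from its conditional law restricted to the codebook. As soon
   as the codebook keeps half of its expected mass, this costs a factor [2 / q]
   and the membership indicator of the drawn sequence, compared with drawing from
   the unrestricted law; so the error events can be averaged under the law of the
   theorem, with independent memberships for the wrong candidates. The codebooks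
   keep enough mass when [q0], [q1], [q2] exceed 2^(-nH) for H = H(U|S0),
   H(V1|U,S0,S1), H(V2|U,S0,S2), and the numbers of plausible candidates are about
   2^(nH) for H = H(V1|X1,U,S0), H(V2|X2,U,S0), H(U,V1,V2|Y). The differences
   between these entropies are the three rate bounds. *)

(** A receiver of two messages usually pays for partial errors with further rate bounds. None arises
    here, because the codebooks of [v1] and [v2] are indexed by [k] as well: a wrong [k] replaces
    all three sequences at once, with independent memberships. Nor is joint covering needed: given
    [u] and the states, the encoders draw [v1] and [v2] independently, exactly as in the law of the
    theorem. Since they draw instead of searching for a typical sequence, the error events become
    expectations under that law, and Chebyshev bounds on sums of log-likelihoods suffice. Two losses
    separate the block code from the theorem. Only [B] of the [B + 1] blocks carry fresh messages,
    so a block works at rate [r * (B + 1) / B]; a fixed large [B] keeps this below a strict bound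
    while the block length grows. Strict bounds come from lowering the rates, which is impossible at
    rate 0, as achievable rates are nonnegative. A zero rate is therefore carried along as a
    separate alternative: it means a single message, hence no wrong candidate. *)

Local Notation "⟦ b ⟧" := ((nat_of_bool b%R)%:R) (b at level 200).

(** * Expectations over finite types *)

Section Expectation.
Context {R : realType}.

Definition Ex (T : finType) (p f : T -> R) : R := \sum_x p x * f x.

Implicit Types T U : finType.

Lemma eq_Ex T (p f g : T -> R) : f =1 g -> Ex p f = Ex p g.
Proof. by move=> fg; apply: eq_bigr => x _; rewrite fg. Qed.

Lemma ExD T (p f g : T -> R) : Ex p (fun x => f x + g x) = Ex p f + Ex p g.
Proof. by rewrite -big_split; apply: eq_bigr => x _; rewrite mulrDr. Qed.

Lemma ExB T (p f g : T -> R) : Ex p (fun x => f x - g x) = Ex p f - Ex p g.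
Proof. by rewrite -sumrB; apply: eq_bigr => x _; rewrite mulrBr. Qed.

Lemma ExZ T (p f : T -> R) (a : R) : Ex p (fun x => a * f x) = a * Ex p f.
Proof. by rewrite mulr_sumr; apply: eq_bigr => x _; rewrite mulrCA. Qed.

Lemma ExZr T (p f : T -> R) (a : R) : Ex p (fun x => f x * a) = Ex p f * a.
Proof. by rewrite mulr_suml; apply: eq_bigr => x _; rewrite mulrA. Qed.

Lemma Ex_sum T U (P : pred U) (p : T -> R) (f : U -> T -> R) :
  Ex p (fun x => \sum_(i | P i) f i x) = \sum_(i | P i) Ex p (f i).
Proof.
by rewrite /Ex exchange_big; apply: eq_bigr => x _; rewrite mulr_sumr.
Qed.

Lemma ExC T U (p : T -> R) (q : U -> R) (f : T -> U -> R) :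
  Ex p (fun x => Ex q (f x)) = Ex q (fun y => Ex p (f^~ y)).
Proof. by rewrite Ex_sum; apply: eq_bigr => y _; rewrite ExZ. Qed.

Lemma Ex_cst T (p : T -> R) (a : R) : is_pmf p -> Ex p (fun=> a) = a.
Proof. by case=> _ p1; rewrite /Ex -mulr_suml p1 mul1r. Qed.

Lemma Ex_le T (p f g : T -> R) :
  is_pmf p -> (forall x, f x <= g x) -> Ex p f <= Ex p g.
Proof. by case=> p0 _ fg; apply: ler_sum => x _; rewrite ler_wpM2l. Qed.

Lemma Ex_le_supp T (p f g : T -> R) :
  is_pmf p -> (forall x, 0 < p x -> f x <= g x) -> Ex p f <= Ex p g.
Proof.
case=> p0 _ fg; apply: ler_sum => x _; have := p0 x.
by rewrite le_eqVlt => /predU1P[<-|px]; rewrite ?mul0r// ler_pM2l// fg.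
Qed.

Lemma eq_Ex_supp T (p f g : T -> R) :
  is_pmf p -> (forall x, 0 < p x -> f x = g x) -> Ex p f = Ex p g.
Proof.
move=> hp fg; apply/eqP; rewrite eq_le !Ex_le_supp// => x /fg -> //.
Qed.

Lemma Ex_ge0 T (p f : T -> R) :
  is_pmf p -> (forall x, 0 <= f x) -> 0 <= Ex p f.
Proof. by case=> p0 _ f0; apply: sumr_ge0 => x _; rewrite mulr_ge0. Qed.

Lemma Ex_le1 T (p f : T -> R) :
  is_pmf p -> (forall x, f x <= 1) -> Ex p f <= 1.
Proof. by move=> hp f1; rewrite -(Ex_cst 1 hp) Ex_le. Qed.

(** Derandomization: applied to the random codebooks and encoding tables one after the other, it
    ends in a fixed code. *)
Lemma exists_le_Ex T (p f : T -> R) : is_pmf p -> exists x, f x <= Ex p f.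
Proof.
move=> hp; apply: contrapT => /forallNP nf.
have fE x : 0 <= f x - Ex p f by rewrite subr_ge0 leNgt; apply/negP => /ltW /nf.
have E0 : Ex p (fun x => f x - Ex p f) = 0 by rewrite ExB Ex_cst// subrr.
have p0 := hp.1; have := hp.2; rewrite big1 => [/esym/eqP|x _].
  by rewrite oner_eq0.
have /eqP := E0; rewrite psumr_eq0 => [|y _]; last by rewrite mulr_ge0.
move=> /allP /(_ x); rewrite mem_index_enum => /(_ isT).
rewrite mulf_eq0 => /orP[/eqP//|/eqP fx].
by case: (nf x); rewrite -subr_le0 fx.
Qed.

Lemma pmf_witness T (p : T -> R) : is_pmf p -> T.
Proof. by move=> /(exists_le_Ex (fun=> 0)) /cid[x]. Qed.

Definition prodp (I T : finType) (P : I -> T -> R) (f : {ffun I -> T}) : R :=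
  \prod_i P i (f i).

Lemma Ex_prodp_prod (I T : finType) (P F : I -> T -> R) :
  Ex (prodp P) (fun f => \prod_i F i (f i)) = \prod_i Ex (P i) (F i).
Proof.
rewrite /Ex bigA_distr_bigA /=; apply: eq_bigr => f _.
by rewrite big_split.
Qed.

Lemma prodp_pmf (I T : finType) (P : I -> T -> R) :
  (forall i, is_pmf (P i)) -> is_pmf (prodp P).
Proof.
move=> hP; split=> [f|]; first by apply: prodr_ge0 => i _; case: (hP i).
by rewrite /prodp -bigA_distr_bigA big1// => i _; case: (hP i).
Qed.

(** Marginalization: coordinates outside the image of [h] integrate to 1. It serves to isolate one
    block among all positions. *)
Lemma Ex_prodp_inj (I J T : finType) (P : I -> T -> R) (h : J -> I)
    (F : {ffun J -> T} -> R) : (forall i, is_pmf (P i)) -> injective h ->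
  Ex (prodp P) (fun f => F [ffun j => f (h j)]) = Ex (prodp (P \o h)) F.
Proof.
move=> hP hinj.
have -> : Ex (prodp P) (fun f => F [ffun j => f (h j)]) =
  Ex (prodp P) (fun f => \sum_g F g * \prod_j (f (h j) == g j)%:R).
  apply: eq_Ex => f; rewrite (bigD1 [ffun j => f (h j)])//=.
  rewrite [X in _ * X]big1 ?mulr1 => [|j _]; last by rewrite ffunE eqxx.
  rewrite big1 ?addr0// => g /eqP ng.
  have [j /negPf nj] : exists j, f (h j) != g j.
    apply: contrapT => /forallNP fg; apply: ng; apply/ffunP => j.
    by rewrite ffunE; apply/esym/eqP/negPn/negP/fg.
  by rewrite (bigD1 j)//= nj mul0r mulr0.
rewrite Ex_sum /Ex; apply: eq_bigr => g _; rewrite -/(Ex _ _) ExZ mulrC.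
congr (_ * _).
(* The point indicator of [g], transported along [h] and extended by 1 elsewhere, so that a product
   over [J] becomes one over [I]. *)
pose F' i t : R := if [pick j | h j == i] is Some j then (t == g j)%:R else 1.
have hF j t : F' (h j) t = (t == g j)%:R.
  rewrite /F'; case: pickP => [j' /eqP /hinj -> //|/(_ j)]; by rewrite eqxx.
have -> : Ex (prodp P) (fun f => \prod_j (f (h j) == g j)%:R) =
   Ex (prodp P) (fun f => \prod_i F' i (f i)).
  apply: eq_Ex => f; rewrite (bigID (mem (h @: predT)))/=.
  rewrite [X in _ * X]big1 ?mulr1 => [|i hi]; last first.
    rewrite /F'; case: pickP => // j /eqP hj.
    by move: hi; rewrite -hj imset_f.
  rewrite big_imset/= => [|j j' _ _ /hinj //].
  by apply: eq_big => [j|j _]; rewrite ?inE// hF.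
rewrite Ex_prodp_prod (bigID (mem (h @: predT)))/=.
rewrite [X in _ * X]big1 ?mulr1 => [|i hi]; last first.
  rewrite -[RHS](Ex_cst 1 (hP i)); apply: eq_Ex => t.
  rewrite /F'; case: pickP => // j /eqP hj.
  by move: hi; rewrite -hj imset_f.
rewrite big_imset/= => [|j j' _ _ /hinj //].
apply: eq_big => [j|j _]; rewrite ?inE// /Ex (bigD1 (g j))//= hF eqxx mulr1.
rewrite big1 ?addr0// => t /negPf ntg.
by rewrite hF ntg mulr0.
Qed.

Lemma Ex_prodp1 (I T : finType) (P : I -> T -> R) i (F : T -> R) :
  (forall i, is_pmf (P i)) -> Ex (prodp P) (fun f => F (f i)) = Ex (P i) F.
Proof.
move=> hP; pose F' j t := if j == i then F t else 1.
transitivity (Ex (prodp P) (fun f => \prod_j F' j (f j))).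
  apply: eq_Ex => f; rewrite (bigD1 i)//= big1 => [|j /negPf ji].
    by rewrite /F' eqxx mulr1.
  by rewrite /F' ji.
rewrite Ex_prodp_prod (bigD1 i)//= big1 => [|j /negPf ji].
  by rewrite /F' eqxx mulr1.
by rewrite /F' ji Ex_cst.
Qed.

Lemma Ex_prodp2 (I T : finType) (P : I -> T -> R) i j (F G : T -> R) :
  (forall i, is_pmf (P i)) -> i != j ->
  Ex (prodp P) (fun f => F (f i) * G (f j)) = Ex (P i) F * Ex (P j) G.
Proof.
move=> hP ij; have ji : (j == i) = false by rewrite eq_sym (negPf ij).
pose F' k t := if k == i then F t else if k == j then G t else 1.
have F'1 k : k != i -> k != j -> F' k = fun=> 1.
  by move=> /negPf ki /negPf kj; rewrite /F' ki kj.
transitivity (Ex (prodp P) (fun f => \prod_k F' k (f k))).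
  apply: eq_Ex => f; rewrite (bigD1 i)//= (bigD1 j)/= ?ji//.
  rewrite big1 ?mulr1 => [|k /andP[ki kj]]; last by rewrite F'1.
  by rewrite /F' eqxx ji eqxx.
rewrite Ex_prodp_prod (bigD1 i)//= (bigD1 j)/= ?ji//.
rewrite big1 ?mulr1 => [|k /andP[ki kj]]; last by rewrite F'1// Ex_cst.
by rewrite /F' eqxx ji eqxx.
Qed.

End Expectation.

(** * Random subsets and resampling *)

Section RandomSets.
Context {R : realType}.

Definition bernoulli_law (q : R) (b : bool) : R := if b then q else 1 - q.

Lemma bernoulli_law_pmf q : 0 <= q <= 1 -> is_pmf (bernoulli_law q).
Proof.
move=> /andP[q0 q1]; split => [[]|]; rewrite /= ?subr_ge0//.
by rewrite big_bool/= addrC subrK.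
Qed.

Lemma Ex_bernoulli_law q : Ex (bernoulli_law q) (fun b => b%:R) = q.
Proof. by rewrite /Ex big_bool/= mulr1 mulr0 addr0. Qed.

Definition random_set (I : finType) (q : R) : {ffun I -> bool} -> R :=
  prodp (fun=> bernoulli_law q).

Variables (q : R) (q01 : 0 <= q <= 1).

Lemma random_set_pmf I : is_pmf (@random_set I q).
Proof. by apply: prodp_pmf => i; exact: bernoulli_law_pmf. Qed.

Lemma Ex_random_set1 (I : finType) (i : I) :
  Ex (random_set q) (fun C => (C i)%:R) = q.
Proof.
rewrite (Ex_prodp1 i (fun b : bool => b%:R : R)) ?Ex_bernoulli_law// => _.
exact: bernoulli_law_pmf.
Qed.

Lemma Ex_random_set2 (I : finType) (i j : I) : i != j ->
  Ex (random_set q) (fun C => (C i)%:R * (C j)%:R) = q * q.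
Proof.
move=> ij; rewrite (Ex_prodp2 (fun b : bool => b%:R : R) (fun b : bool => b%:R : R) _ ij).
  by rewrite Ex_bernoulli_law.
by move=> _; exact: bernoulli_law_pmf.
Qed.

(* The weights are truncated at [g], so that the sampled mass has variance at
   most [g * q * (1 - q)]. *)
Lemma covering (T I : finType) (A : T -> R) (x : T -> I) (g : R) :
  is_pmf A -> injective x -> 0 < q -> 0 <= g ->
  Ex (random_set q) (fun C => ⟦ Ex A (fun t => (C (x t))%:R) < q / 2 ⟧)
  <= 4 * Ex A (fun t => ⟦ g < A t ⟧) + 16 * (g * (1 - q) / q).
Proof.
move=> hA xinj q0 g0; have [A0 A1] := hA.
pose a t := if g < A t then 0 else A t.
have a0 t : 0 <= a t by rewrite /a; case: ifP.
have ag t : a t <= g by rewrite /a; case: ltP.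
have aA t : a t <= A t by rewrite /a; case: ifP.
pose m := \sum_t a t.
have mE : 1 - m = Ex A (fun t => ⟦ g < A t ⟧).
  rewrite -{1}A1 -sumrB; apply: eq_bigr => t _; rewrite /a.
  by case: ifP => _ /=; rewrite ?mulr1 ?mulr0 ?subr0 ?subrr.
have m1 : m <= 1 by rewrite -A1; apply: ler_sum.
pose Z (C : {ffun I -> bool}) := \sum_t a t * (C (x t))%:R.
have ZE : Ex (random_set q) (fun C => (Z C - q * m) ^+ 2) <= q * (1 - q) * g.
  (* Memberships at distinct points are uncorrelated, so only the diagonal of the square will
     survive. *)
  have E1 t s : Ex (random_set q) (fun C : {ffun I -> bool} =>
      ((C (x t))%:R - q) * ((C (x s))%:R - q)) = (t == s)%:R * (q * (1 - q)).
    transitivity (Ex (random_set q) (fun C : {ffun I -> bool} =>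
      (C (x t))%:R * (C (x s))%:R + (- q) * (C (x t))%:R + (- q) * (C (x s))%:R
        + q * q)).
      by apply: eq_Ex => C; ring.
    have hp := random_set_pmf I.
    rewrite !ExD !ExZ !Ex_random_set1 Ex_cst//.
    have [->|ts] := eqVneq t s.
      rewrite (_ : Ex _ _ = q) ?mul1r; last first.
        by rewrite -[RHS](Ex_random_set1 (x s)); apply: eq_Ex => C; case: (C _);
          rewrite ?mulr1 ?mulr0.
      by ring.
    by rewrite Ex_random_set2 ?(inj_eq xinj)//=; ring.
  have -> : Ex (random_set q) (fun C => (Z C - q * m) ^+ 2) =
      \sum_t a t * a t * (q * (1 - q)).
    transitivity (Ex (random_set q) (fun C : {ffun I -> bool} =>
       \sum_t \sum_s a t * a s * (((C (x t))%:R - q) * ((C (x s))%:R - q)))).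
      apply: eq_Ex => C; rewrite /Z /m mulr_sumr -sumrB expr2 mulr_suml.
      apply: eq_bigr => t _; rewrite mulr_sumr; apply: eq_bigr => s _; ring.
    rewrite Ex_sum; apply: eq_bigr => t _; rewrite Ex_sum (bigD1 t)//= ExZ E1 eqxx.
    rewrite mul1r big1 ?addr0// => s st.
    by rewrite ExZ E1 eq_sym (negPf st) mul0r mulr0.
  have [_ q1] := andP q01.
  rewrite -mulr_suml [X in X <= _]mulrC; apply: ler_wpM2l.
    by rewrite mulr_ge0 ?subr_ge0// ltW.
  apply: (@le_trans _ _ (\sum_t A t * g)).
    by apply: ler_sum => t _; rewrite ler_pM.
  by rewrite -mulr_suml A1 mul1r.
(* A sampled mass below [q / 2] has two possible causes, split at [m = 3/4]: either truncation
   removed at least a quarter of the mass, and [4 * (1 - m)] is at least 1, or [Z C] is [q / 4]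
   short of its mean, and the squared term is at least 1. *)
apply: (@le_trans _ _ (Ex (random_set q) (fun C : {ffun I -> bool} =>
    4 * (1 - m) + 16 / (q * q) * (Z C - q * m) ^+ 2))).
  apply: Ex_le => [|C]; first exact: random_set_pmf.
  have h0 : 0 <= 16 / (q * q) * (Z C - q * m) ^+ 2.
    by rewrite mulr_ge0 ?sqr_ge0// divr_ge0// mulr_ge0// ltW.
  case: ltP => hZ /=; last by lra.
  have hZ' : Z C < q / 2.
    apply: le_lt_trans hZ; apply: ler_sum => t _.
    by rewrite ler_wpM2r.
  have [m34|m34] := leP m (3/4); first by lra.
  suff : 1 <= 16 / (q * q) * (Z C - q * m) ^+ 2 by lra.
  rewrite mulrAC ler_pdivlMr ?mulr_gt0// mul1r.
  have : q * m - Z C >= q / 4.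
    have : q * (3/4) <= q * m by rewrite ler_wpM2l// ltW.
    by lra.
  by move=> h; nra.
have hp := random_set_pmf I.
rewrite ExD (Ex_cst _ hp) ExZ -mE lerD2l.
apply: (@le_trans _ _ (16 / (q * q) * (q * (1 - q) * g))).
  by rewrite ler_wpM2l// divr_ge0// mulr_ge0 ?ltW.
rewrite le_eqVlt; apply/orP; left; apply/eqP; field.
by rewrite lt0r_neq0.
Qed.

End RandomSets.

Section Resampling.
Context {R : realType}.

(** The law [A] conditioned on [b]; the fallback on [A] keeps it a law even when [b] is a null
    event. *)
Definition resample (T : finType) (A : T -> R) (b : pred T) (t : T) : R :=
  let Z := Ex A (fun t => (b t)%:R) in
  if Z == 0 then A t else A t * (b t)%:R / Z.

Lemma resample_pmf (T : finType) (A : T -> R) (b : pred T) :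
  is_pmf A -> is_pmf (resample A b).
Proof.
move=> hA; have [A0 A1] := hA; rewrite /resample; case: eqVneq => // Z0.
split=> [t|]; last by rewrite -mulr_suml mulfV.
by rewrite divr_ge0 ?mulr_ge0 ?Ex_ge0.
Qed.

(** The indicator [b t] stays inside the expectation: averaged over the codebook, it gives back the
    factor [q] paid in [2 / q]. *)
Lemma Ex_resample_le (T : finType) (A : T -> R) (b : pred T) (G : T -> R) (q : R) :
  is_pmf A -> 0 < q -> (forall t, 0 <= G t <= 1) ->
  Ex (resample A b) G <=
    2 / q * Ex A (fun t => (b t)%:R * G t) + ⟦ Ex A (fun t => (b t)%:R) < q / 2 ⟧.
Proof.
move=> hA q0 hG.
have G0 t : 0 <= G t by have /andP[] := hG t.
have [_|hZ] := ltP; last first.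
  rewrite addr0 /resample; case: eqVneq => [Z0|_].
    by move: hZ; rewrite Z0; lra.
  rewrite /Ex mulr_sumr ler_sum// => t _.
  have [A0 _] := hA.
  rewrite [X in X <= _](_ : _ = (Ex A (fun t => (b t)%:R))^-1 * (A t * ((b t)%:R * G t))).
    apply: ler_wpM2r; first by rewrite !mulr_ge0.
    rewrite -[X in _ <= X]invrK invf_div lef_pV2// posrE; lra.
  by rewrite [in RHS]mulrA; ring.
apply: (@le_trans _ _ 1).
  by apply: Ex_le1 => [|t]; [exact: resample_pmf|have /andP[] := hG t].
rewrite lerDr mulr_ge0//; first by rewrite divr_ge0// ltW.
by apply: Ex_ge0 => // t; rewrite mulr_ge0.
Qed.

End Resampling.

(** * Coding for one block *)

Definition marginal2 {R : realType} {X V : finType} (p : X * V -> R) (v : V) : R :=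
  \sum_x p (x, v).

Lemma Ex_marginal2 (R : realType) (X V : finType) (p : X * V -> R) (F : V -> R) :
  Ex p (fun a => F a.2) = Ex (marginal2 p) F.
Proof.
transitivity (\sum_x \sum_v p (x, v) * F v).
  by rewrite pair_bigA; apply: eq_bigr => -[].
by rewrite exchange_big; apply: eq_bigr => v _; rewrite mulr_suml.
Qed.

Lemma marginal2_pmf (R : realType) (X V : finType) (p : X * V -> R) :
  is_pmf p -> is_pmf (marginal2 p).
Proof.
move=> hp; split=> [v|]; first by apply: sumr_ge0 => x _; case: hp.
by rewrite -(Ex_cst 1 hp) (Ex_marginal2 p (fun=> 1)) /Ex; under [RHS]eq_bigr do rewrite mulr1.
Qed.

(** * The single-letter joint law as a nested expectation *)

Section JointLaw.
Context {R : realType} {X1 X2 S0 S1 S2 Y U V1 V2 : finType}.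
Variables (PS0 : S0 -> R) (PS1 : S1 -> R) (PS2 : S2 -> R).
Variables (W : X1 -> X2 -> S0 -> S1 -> S2 -> Y -> R).
Variables (PU : S0 -> U -> R) (P1 : U -> S0 -> S1 -> X1 * V1 -> R).
Variables (P2 : U -> S0 -> S2 -> X2 * V2 -> R).

Local Notation P := (joint_law PS0 PS1 PS2 W PU P1 P2).

Lemma Ex_joint_law f :
  Ex P f = Ex PS0 (fun s0 => Ex PS1 (fun s1 => Ex PS2 (fun s2 =>
    Ex (PU s0) (fun u => Ex (P1 u s0 s1) (fun a => Ex (P2 u s0 s2) (fun b =>
      Ex (W a.1 b.1 s0 s1 s2) (fun y =>
        f (s0, s1, s2, u, a.2, b.2, a.1, b.1, y)))))))).
Proof.
pose h (t : S0 * S1 * S2 * U * (X1 * V1) * (X2 * V2) * Y) :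
    outcome :=
  let: (s0, s1, s2, u, (x1, v1), (x2, v2), y) := t in
  (s0, s1, s2, u, v1, v2, x1, x2, y).
have sum_pair (A B : finType) (F : A * B -> R) :
    \sum_w F w = \sum_a \sum_b F (a, b).
  by rewrite pair_bigA; apply: eq_bigr => -[].
rewrite [LHS](reindex h)/=; last first.
  exists (fun w : outcome => let: (s0, s1, s2, u, v1, v2, x1, x2, y) := w in
    (s0, s1, s2, u, (x1, v1), (x2, v2), y)).
    by move=> t _; case: t => -[[[[[? ?] ?] ?] [? ?]] [? ?]] ?.
  by move=> t _; case: t => -[[[[[[[? ?] ?] ?] ?] ?] ?] ?] ?.
do 6 rewrite sum_pair.
apply: eq_bigr => s0 _; rewrite mulr_sumr; apply: eq_bigr => s1 _.
do 2 rewrite mulr_sumr; apply: eq_bigr => s2 _.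
do 3 rewrite mulr_sumr; apply: eq_bigr => u _.
do 4 rewrite mulr_sumr; apply: eq_bigr => -[x1 v1] _.
do 5 rewrite mulr_sumr; apply: eq_bigr => -[x2 v2] _.
do 6 rewrite mulr_sumr; apply: eq_bigr => y _ /=.
by rewrite !mulrA.
Qed.

Hypotheses (hPS0 : is_pmf PS0) (hPS1 : is_pmf PS1) (hPS2 : is_pmf PS2).
Hypothesis hW : forall x1 x2 s0 s1 s2, is_pmf (W x1 x2 s0 s1 s2).
Hypothesis hPU : forall s0, is_pmf (PU s0).
Hypothesis hP1 : forall u s0 s1, is_pmf (P1 u s0 s1).
Hypothesis hP2 : forall u s0 s2, is_pmf (P2 u s0 s2).

Lemma Ex_from_X2V2 s0 s1 s2 u x1 (z : R) : Ex (P2 u s0 s2) (fun b =>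
  Ex (W x1 b.1 s0 s1 s2) (fun=> z)) = z.
Proof.
by rewrite -[RHS](Ex_cst z (hP2 u s0 s2)); apply: eq_Ex => b; rewrite Ex_cst.
Qed.

Lemma Ex_from_X1V1 s0 s1 s2 u (z : R) : Ex (P1 u s0 s1) (fun a =>
  Ex (P2 u s0 s2) (fun b => Ex (W a.1 b.1 s0 s1 s2) (fun=> z))) = z.
Proof.
rewrite -[RHS](Ex_cst z (hP1 u s0 s1)); apply: eq_Ex => a; exact: Ex_from_X2V2.
Qed.

Lemma joint_law_pmf : is_pmf P.
Proof.
split=> [[[[[[[[[s0 s1] s2] u] v1] v2] x1] x2] y]|].
  rewrite /joint_law !mulr_ge0//.
  - by have [] := hPS0.
  - by have [] := hPS1.
  - by have [] := hPS2.
  - by have [] := hPU s0.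
  - by have [] := hP1 u s0 s1.
  - by have [] := hP2 u s0 s2.
  - by have [] := hW x1 x2 s0 s1 s2.
transitivity (Ex P (fun=> 1)); first by apply: eq_bigr => w _; rewrite mulr1.
rewrite Ex_joint_law -[RHS](Ex_cst 1 hPS0); apply: eq_Ex => s0.
rewrite -[RHS](Ex_cst 1 hPS1); apply: eq_Ex => s1.
rewrite -[RHS](Ex_cst 1 hPS2); apply: eq_Ex => s2.
by rewrite -[RHS](Ex_cst 1 (hPU s0)); apply: eq_Ex => u; exact: Ex_from_X1V1.
Qed.

Lemma joint_law_pos w : 0 < P w -> [/\ 0 < PU (rv_S0 w) (rv_U w),
  0 < marginal2 (P1 (rv_U w) (rv_S0 w) (rv_S1 w)) (rv_V1 w) &
  0 < marginal2 (P2 (rv_U w) (rv_S0 w) (rv_S2 w)) (rv_V2 w)].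
Proof.
case: w => -[[[[[[[s0 s1] s2] u] v1] v2] x1] x2] y /= hp.
have [U0 _] := hPU s0; have [P10 _] := hP1 u s0 s1; have [P20 _] := hP2 u s0 s2.
have neq0 : [&& PU s0 u != 0, P1 u s0 s1 (x1, v1) != 0 & P2 u s0 s2 (x2, v2) != 0].
  by apply: contraTT hp; rewrite !negb_and !negbK => /or3P[] /eqP ->;
    rewrite !(mulr0, mul0r) ltxx.
case/and3P: neq0 => h0 h1 h2; split; first by rewrite lt_neqAle eq_sym h0 U0.
  rewrite /marginal2 (bigD1 x1)//= ltr_pwDl ?sumr_ge0//.
  by rewrite lt_neqAle eq_sym h1 P10.
rewrite /marginal2 (bigD1 x2)//= ltr_pwDl ?sumr_ge0//.
by rewrite lt_neqAle eq_sym h2 P20.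
Qed.

End JointLaw.

(** * Threshold decoding *)

Section Thresholds.
Context {R : realType}.

Lemma sum_gt_le (T : finType) (f : T -> R) t :
  (forall v, 0 <= f v) -> \sum_v f v <= 1 -> 0 < t ->
  \sum_v ⟦ t < f v ⟧ <= t^-1.
Proof.
move=> f0 f1 t_gt0; rewrite -[leRHS]mul1r ler_pdivlMr// mulr_suml.
apply: le_trans f1; apply: ler_sum => v _.
by case: ltP => [/ltW|_]; rewrite ?mul1r ?mul0r.
Qed.

(** The search may return any message owning a plausible codeword, so it errs only if the true
    codeword misses the threshold or another message owns a plausible one; the double sum is the
    union bound. *)
Lemma threshold_failure (M V : finType) (C : M -> V -> bool) (f : V -> R)
    (t : R) (d m : M) (v : V) : C m v ->
  ⟦ odflt d [pick m | [exists v, C m v && (t < f v)]] != m ⟧ <=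
    ⟦ f v <= t ⟧ + \sum_(m' | m' != m) \sum_v' ⟦ t < f v' ⟧ * ⟦ C m' v' ⟧ :> R.
Proof.
move=> Cmv; have S0 : 0 <= \sum_(m' | m' != m) \sum_v' ⟦ t < f v' ⟧ * ⟦ C m' v' ⟧ :> R.
  by apply: sumr_ge0 => m' _; apply: sumr_ge0 => v' _; rewrite mulr_ge0.
case: (leP (f v) t) => [_|tv].
  by rewrite ler_wpDr//; case: (_ != _).
rewrite add0r; case: pickP => [m' /fintype.existsP[v' /andP[Cv' tv']]|none]/=; last first.
  by case/negP: (negbT (none m)); apply/fintype.existsP; exists v; rewrite Cmv.
have [_//|m'm] := eqVneq m' m.
rewrite (bigD1 m')//= (bigD1 v')//= tv' Cv' mulr1 -addrA lerDl addr_ge0//.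
  by apply: sumr_ge0 => i _; rewrite mulr_ge0.
by apply: sumr_ge0 => i _; apply: sumr_ge0 => j _; rewrite mulr_ge0.
Qed.

End Thresholds.

(** * Random coding for a single use of arbitrary finite alphabets *)

Section OneShot.
Context {R : realType} {X1 X2 S0 S1 S2 Y U V1 V2 M1 M2 : finType}.
Variables (PS0 : S0 -> R) (PS1 : S1 -> R) (PS2 : S2 -> R).
Variables (W : X1 -> X2 -> S0 -> S1 -> S2 -> Y -> R).

Local Notation K := (M1 * M2)%type.

(* A code for one block: [k] is the message pair of the previous block and [m]
   that of the current one. Each encoder recovers the message of the other one
   from [k], the common state and the symbols of the other encoder, and the
   receiver recovers [k] from [m] and the channel output. *)
Record block_code := BlockCode {
  benc1 : K -> M1 -> S0 -> S1 -> X1;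
  benc2 : K -> M2 -> S0 -> S2 -> X2;
  bdec1 : K -> S0 -> X2 -> M2;
  bdec2 : K -> S0 -> X1 -> M1;
  bdec : K -> Y -> K }.

Definition block_failure (c : block_code) (k m : K) (s0 : S0)
    (x1 : X1) (x2 : X2) (y : Y) : bool :=
  [|| bdec2 c k s0 x1 != m.1, bdec1 c k s0 x2 != m.2 | bdec c m y != k].

Definition block_error_prob (c : block_code) (k m : K) : R :=
  Ex PS0 (fun s0 => Ex PS1 (fun s1 => Ex PS2 (fun s2 =>
    let x1 := benc1 c k m.1 s0 s1 in let x2 := benc2 c k m.2 s0 s2 in
    Ex (W x1 x2 s0 s1 s2) (fun y => ⟦ block_failure c k m s0 x1 x2 y ⟧)))).

Variables (PU : S0 -> U -> R) (P1 : U -> S0 -> S1 -> X1 * V1 -> R).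
Variables (P2 : U -> S0 -> S2 -> X2 * V2 -> R).

Hypotheses (hPS0 : is_pmf PS0) (hPS1 : is_pmf PS1) (hPS2 : is_pmf PS2).
Hypothesis hW : forall x1 x2 s0 s1 s2, is_pmf (W x1 x2 s0 s1 s2).
Hypothesis hPU : forall s0, is_pmf (PU s0).
Hypothesis hP1 : forall u s0 s1, is_pmf (P1 u s0 s1).
Hypothesis hP2 : forall u s0 s2, is_pmf (P2 u s0 s2).

Local Notation P := (joint_law PS0 PS1 PS2 W PU P1 P2).

(* The decoders keep the candidates whose score exceeds a threshold; the scores
   [f1], [f2], [f0] stand for the posterior laws of [V1] given [(U, S0, X1)], of
   [V2] given [(U, S0, X2)] and of [(U, V1, V2)] given [Y]. *)
Variables (f1 : U -> S0 -> X1 -> V1 -> R) (f2 : U -> S0 -> X2 -> V2 -> R).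
Variable (f0 : Y -> U * V1 * V2 -> R).
Variables (q0 q1 q2 t0 t1 t2 g0 g1 g2 : R).

(* The codebooks are independent random subsets of [U], [V1], [V2], one for each
   value of the messages they encode. *)
Local Notation book0 := {ffun K * U -> bool}.
Local Notation book1 := {ffun K * M1 * V1 -> bool}.
Local Notation book2 := {ffun K * M2 * V2 -> bool}.

(** The default [k.1] is merely an element of [M1] that is at hand. *)
Definition guess1 (C : book1) k u s0 x1 : M1 :=
  odflt k.1 [pick m | [exists v, C (k, m, v) && (t1 < f1 u s0 x1 v)]].
Definition guess2 (C : book2) k u s0 x2 : M2 :=
  odflt k.2 [pick m | [exists v, C (k, m, v) && (t2 < f2 u s0 x2 v)]].
Definition guess0 (C0 : book0) (C1 : book1) (C2 : book2) (m : K) y : K :=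
  odflt m [pick k | [exists v : U * V1 * V2,
    [&& C0 (k, v.1.1), C1 (k, m.1, v.1.2) & C2 (k, m.2, v.2)] && (t0 < f0 y v)]].

(** The random draws are tabulated in advance, so that fixing the tables gives deterministic
    encoders. Both encoders read the same table [e0], hence agree on [u]. *)
Definition random_code (C0 : book0) (C1 : book1) (C2 : book2)
    (e0 : {ffun K * S0 -> U}) (e1 : {ffun K * M1 * S0 * S1 * U -> X1 * V1})
    (e2 : {ffun K * M2 * S0 * S2 * U -> X2 * V2}) : block_code := {|
  benc1 k m s0 s1 := (e1 (k, m, s0, s1, e0 (k, s0))).1;
  benc2 k m s0 s2 := (e2 (k, m, s0, s2, e0 (k, s0))).1;
  bdec1 k s0 x2 := guess2 C2 k (e0 (k, s0)) s0 x2;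
  bdec2 k s0 x1 := guess1 C1 k (e0 (k, s0)) s0 x1;
  bdec := guess0 C0 C1 C2 |}.

Definition failure C0 C1 C2 (k m : K) u s0 x1 x2 y : bool :=
  [|| guess1 C1 k u s0 x1 != m.1, guess2 C2 k u s0 x2 != m.2
    | guess0 C0 C1 C2 m y != k].

Definition law_e0 (C0 : book0) :=
  prodp (fun z : K * S0 => resample (PU z.2) (fun u => C0 (z.1, u))).
Definition law_e1 (C1 : book1) :=
  prodp (fun z : K * M1 * S0 * S1 * U => let: (k, m, s0, s1, u) := z in
    resample (P1 u s0 s1) (fun a => C1 (k, m, a.2))).
Definition law_e2 (C2 : book2) :=
  prodp (fun z : K * M2 * S0 * S2 * U => let: (k, m, s0, s2, u) := z in
    resample (P2 u s0 s2) (fun a => C2 (k, m, a.2))).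

Lemma law_e0_pmf C0 : is_pmf (law_e0 C0).
Proof. by apply: prodp_pmf => -[k s0]; exact: resample_pmf. Qed.

Lemma law_e1_pmf C1 : is_pmf (law_e1 C1).
Proof. by apply: prodp_pmf => -[[[[k m] s0] s1] u]; exact: resample_pmf. Qed.

Lemma law_e2_pmf C2 : is_pmf (law_e2 C2).
Proof. by apply: prodp_pmf => -[[[[k m] s0] s2] u]; exact: resample_pmf. Qed.

(** For given messages and states, only one entry of each table is read, so averaging over a table
    amounts to a single draw. *)
Lemma Ex_random_code C0 C1 C2 k m :
  Ex (law_e0 C0) (fun e0 => Ex (law_e1 C1) (fun e1 => Ex (law_e2 C2) (fun e2 =>
    block_error_prob (random_code C0 C1 C2 e0 e1 e2) k m))) =
  Ex PS0 (fun s0 => Ex PS1 (fun s1 => Ex PS2 (fun s2 =>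
    Ex (resample (PU s0) (fun u => C0 (k, u))) (fun u =>
    Ex (resample (P1 u s0 s1) (fun a => C1 (k, m.1, a.2))) (fun a =>
    Ex (resample (P2 u s0 s2) (fun b => C2 (k, m.2, b.2))) (fun b =>
      Ex (W a.1 b.1 s0 s1 s2) (fun y => ⟦ failure C0 C1 C2 k m u s0 a.1 b.1 y ⟧))))))).
Proof.
pose ET F := Ex (law_e0 C0) (fun e0 => Ex (law_e1 C1) (fun e1 =>
  Ex (law_e2 C2) (fun e2 => F e0 e1 e2))).
have ETE (T : finType) (p : T -> R) F :
    ET (fun e0 e1 e2 => Ex p (F e0 e1 e2)) =
    Ex p (fun x => ET (fun e0 e1 e2 => F e0 e1 e2 x)).
  rewrite /ET [RHS]ExC; apply: eq_Ex => e0; rewrite [RHS]ExC.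
  by apply: eq_Ex => e1; rewrite [RHS]ExC.
rewrite -[LHS]/(ET _) ETE; apply: eq_Ex => s0.
rewrite ETE; apply: eq_Ex => s1; rewrite ETE; apply: eq_Ex => s2.
have h0 z : is_pmf (resample (PU z.2) (fun u => C0 (z.1, u))) by exact: resample_pmf.
have h1 (z : K * M1 * S0 * S1 * U) : is_pmf (let: (k, m, s0, s1, u) := z in
    resample (P1 u s0 s1) (fun a => C1 (k, m, a.2))).
  by move: z => [[[[? ?] ?] ?] ?]; exact: resample_pmf.
have h2 (z : K * M2 * S0 * S2 * U) : is_pmf (let: (k, m, s0, s2, u) := z in
    resample (P2 u s0 s2) (fun a => C2 (k, m, a.2))).
  by move: z => [[[[? ?] ?] ?] ?]; exact: resample_pmf.
rewrite -(Ex_prodp1 (k, s0) _ h0); apply: eq_Ex => e0.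
rewrite -(Ex_prodp1 (k, m.1, s0, s1, e0 (k, s0)) _ h1); apply: eq_Ex => e1.
by rewrite -(Ex_prodp1 (k, m.2, s0, s2, e0 (k, s0)) _ h2); apply: eq_Ex => e2.
Qed.


Hypotheses (hq0 : 0 < q0 <= 1) (hq1 : 0 < q1 <= 1) (hq2 : 0 < q2 <= 1).

Let q0_gt0 : 0 < q0. Proof. by case/andP: hq0. Qed.
Let q1_gt0 : 0 < q1. Proof. by case/andP: hq1. Qed.
Let q2_gt0 : 0 < q2. Proof. by case/andP: hq2. Qed.
Let q0_01 : 0 <= q0 <= 1. Proof. by case/andP: hq0 => /ltW -> ->. Qed.
Let q1_01 : 0 <= q1 <= 1. Proof. by case/andP: hq1 => /ltW -> ->. Qed.
Let q2_01 : 0 <= q2 <= 1. Proof. by case/andP: hq2 => /ltW -> ->. Qed.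

Local Notation thin0 C0 k s0 :=
  ⟦ Ex (PU s0) (fun u => (C0 (k, u))%:R) < q0 / 2 ⟧.
Local Notation thin1 C1 k m s0 s1 u :=
  ⟦ Ex (P1 u s0 s1) (fun a => (C1 (k, m, a.2))%:R) < q1 / 2 ⟧.
Local Notation thin2 C2 k m s0 s2 u :=
  ⟦ Ex (P2 u s0 s2) (fun a => (C2 (k, m, a.2))%:R) < q2 / 2 ⟧.

(** The result of applying [Ex_resample_le] to [u], [v1], [v2] in turn: each layer is the indicator
    of a codebook that kept too little mass, plus the weighted membership times the next layer. *)
Let risk (C0 : book0) (C1 : book1) (C2 : book2) (k m : K) s0 s1 s2 u v1 v2 x1 x2 y : R :=
  thin0 C0 k s0 + 2 / q0 * ((C0 (k, u))%:R * (
  thin1 C1 k m.1 s0 s1 u + 2 / q1 * ((C1 (k, m.1, v1))%:R * (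
  thin2 C2 k m.2 s0 s2 u + 2 / q2 * ((C2 (k, m.2, v2))%:R *
  ⟦ failure C0 C1 C2 k m u s0 x1 x2 y ⟧))))).

Let Ex_affine (T : finType) (p h : T -> R) z d b : is_pmf p ->
  Ex p (fun x => z + d * (b * h x)) = z + d * (b * Ex p h).
Proof. by move=> hp; rewrite ExD Ex_cst// !ExZ. Qed.

Let Ex_01 (T : finType) (p h : T -> R) : is_pmf p ->
  (forall x, 0 <= h x <= 1) -> 0 <= Ex p h <= 1.
Proof.
move=> hp h01; rewrite Ex_ge0 ?Ex_le1// => x; by case/andP: (h01 x).
Qed.

Lemma random_code_error_le C0 C1 C2 k m :
  Ex (law_e0 C0) (fun e0 => Ex (law_e1 C1) (fun e1 => Ex (law_e2 C2) (fun e2 =>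
    block_error_prob (random_code C0 C1 C2 e0 e1 e2) k m))) <=
  Ex P (fun w => let: (s0, s1, s2, u, v1, v2, x1, x2, y) := w in
    risk C0 C1 C2 k m s0 s1 s2 u v1 v2 x1 x2 y).
Proof.
rewrite Ex_random_code Ex_joint_law; apply: Ex_le => // s0.
apply: Ex_le => // s1; apply: Ex_le => // s2.
have F01 u a b y : 0 <= (⟦ failure C0 C1 C2 k m u s0 a b y ⟧ : R) <= 1.
  by case: (failure _ _ _ _ _ _ _ _ _ _); rewrite ?lexx ?ler01.
apply: le_trans.
  apply: (Ex_resample_le _ _ q0_gt0) => // u.
  do 2 (apply: Ex_01 => [|?]; first exact: resample_pmf).
  by apply: Ex_01.
rewrite addrC -ExZ -{1}(Ex_cst (thin0 C0 k s0) (hPU s0)) -ExD.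
apply: Ex_le => // u; rewrite /risk.
(* Each layer is affine in what follows it, so its constants pass through the expectations of the
   later variables. *)
apply: (@le_trans _ _ (thin0 C0 k s0 + 2 / q0 * ((C0 (k, u))%:R * 
   Ex (P1 u s0 s1) (fun a => Ex (P2 u s0 s2) (fun b => Ex (W a.1 b.1 s0 s1 s2) (fun y => 
  thin1 C1 k m.1 s0 s1 u + 2 / q1 * ((C1 (k, m.1, a.2))%:R * (
  thin2 C2 k m.2 s0 s2 u + 2 / q2 * ((C2 (k, m.2, b.2))%:R *
  ⟦ failure C0 C1 C2 k m u s0 a.1 b.1 y ⟧))))))))); last first.
  rewrite -Ex_affine//; apply: Ex_le => // a; rewrite -Ex_affine//.
  by apply: Ex_le => // b; rewrite -Ex_affine.
rewrite lerD2l; apply: ler_wpM2l; first by rewrite divr_ge0// ltW.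
apply: ler_wpM2l => //.
apply: le_trans.
  apply: (Ex_resample_le _ _ q1_gt0) => // a.
  apply: Ex_01 => [|?]; first exact: resample_pmf.
  by apply: Ex_01.
rewrite addrC -ExZ -{1}(Ex_cst (thin1 C1 k m.1 s0 s1 u) (hP1 u s0 s1)) -ExD.
apply: Ex_le => // a.
apply: (@le_trans _ _ (thin1 C1 k m.1 s0 s1 u + 2 / q1 * ((C1 (k, m.1, a.2))%:R * 
   Ex (P2 u s0 s2) (fun b => Ex (W a.1 b.1 s0 s1 s2) (fun y => 
  thin2 C2 k m.2 s0 s2 u + 2 / q2 * ((C2 (k, m.2, b.2))%:R *
  ⟦ failure C0 C1 C2 k m u s0 a.1 b.1 y ⟧)))))); last first.
  by rewrite -Ex_affine//; apply: Ex_le => // b; rewrite -Ex_affine.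
rewrite lerD2l; apply: ler_wpM2l; first by rewrite divr_ge0// ltW.
apply: ler_wpM2l => //.
apply: le_trans.
  by apply: (Ex_resample_le _ _ q2_gt0) => // b; exact: Ex_01.
rewrite addrC -ExZ -{1}(Ex_cst (thin2 C2 k m.2 s0 s2 u) (hP2 u s0 s2)) -ExD.
by apply: Ex_le => // b; rewrite Ex_affine.
Qed.

Hypotheses (hg0 : 0 <= g0) (hg1 : 0 <= g1) (hg2 : 0 <= g2).
Hypotheses (ht0 : 0 < t0) (ht1 : 0 < t1) (ht2 : 0 < t2).
Hypotheses (f0_ge0 : forall y v, 0 <= f0 y v) (f0_le1 : forall y, \sum_v f0 y v <= 1).
Hypotheses (f1_ge0 : forall u s0 x v, 0 <= f1 u s0 x v)
  (f1_le1 : forall u s0 x, \sum_v f1 u s0 x v <= 1).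
Hypotheses (f2_ge0 : forall u s0 x v, 0 <= f2 u s0 x v)
  (f2_le1 : forall u s0 x, \sum_v f2 u s0 x v <= 1).

Let EC F : R := Ex (@random_set _ _ q0) (fun C0 : book0 =>
  Ex (@random_set _ _ q1) (fun C1 : book1 =>
  Ex (@random_set _ _ q2) (fun C2 : book2 => F C0 C1 C2))).

Let r0 : is_pmf (@random_set R (K * U)%type q0). Proof. exact: random_set_pmf. Qed.
Let r1 : is_pmf (@random_set R (K * M1 * V1)%type q1). Proof. exact: random_set_pmf. Qed.
Let r2 : is_pmf (@random_set R (K * M2 * V2)%type q2). Proof. exact: random_set_pmf. Qed.

Let EC_le F G : (forall C0 C1 C2, F C0 C1 C2 <= G C0 C1 C2) -> EC F <= EC G.
Proof. by move=> FG; do 3 (apply: Ex_le => // ?); exact: FG. Qed.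

Let ECD F G :
  EC (fun C0 C1 C2 => F C0 C1 C2 + G C0 C1 C2) = EC F + EC G.
Proof.
rewrite /EC -ExD; apply: eq_Ex => C0; rewrite -ExD; apply: eq_Ex => C1.
by rewrite -ExD.
Qed.

Let ECZ a F : EC (fun C0 C1 C2 => a * F C0 C1 C2) = a * EC F.
Proof.
rewrite /EC -ExZ; apply: eq_Ex => C0; rewrite -ExZ; apply: eq_Ex => C1.
by rewrite -ExZ.
Qed.

Let EC_sum (T : finType) (Q : pred T) F :
  EC (fun C0 C1 C2 => \sum_(i | Q i) F i C0 C1 C2) = \sum_(i | Q i) EC (F i).
Proof.
rewrite /EC -Ex_sum; apply: eq_Ex => C0; rewrite -Ex_sum; apply: eq_Ex => C1.
by rewrite -Ex_sum.
Qed.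

Let EC_Ex (T : finType) (p : T -> R) F :
  EC (fun C0 C1 C2 => Ex p (F C0 C1 C2)) = Ex p (fun x => EC (fun C0 C1 C2 => F C0 C1 C2 x)).
Proof.
rewrite /EC [RHS]ExC; apply: eq_Ex => C0; rewrite [RHS]ExC.
by apply: eq_Ex => C1; rewrite [RHS]ExC.
Qed.

Let EC_prod F0 F1 F2 : EC (fun C0 C1 C2 => F0 C0 * (F1 C1 * F2 C2)) =
  Ex (@random_set _ _ q0) F0 * (Ex (@random_set _ _ q1) F1 * Ex (@random_set _ _ q2) F2).
Proof.
rewrite /EC -ExZr; apply: eq_Ex => C0; rewrite -ExZr -ExZ.
by apply: eq_Ex => C1; rewrite !ExZ.
Qed.

Let cover0 s0 := 4 * Ex (PU s0) (fun u => ⟦ g0 < PU s0 u ⟧) + 16 * (g0 * (1 - q0) / q0).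
Let cover1 u s0 s1 := 4 * Ex (P1 u s0 s1) (fun a => ⟦ g1 < marginal2 (P1 u s0 s1) a.2 ⟧)
  + 16 * (g1 * (1 - q1) / q1).
Let cover2 u s0 s2 := 4 * Ex (P2 u s0 s2) (fun a => ⟦ g2 < marginal2 (P2 u s0 s2) a.2 ⟧)
  + 16 * (g2 * (1 - q2) / q2).

Let thin0_le k s0 : Ex (random_set q0) (fun C0 : book0 => thin0 C0 k s0) <= cover0 s0.
Proof. by apply: (@covering R q0 _ U (K * U)%type (PU s0) (fun u => (k, u)) g0) => // u v []. Qed.

Let thin1_le k m s0 s1 u :
  Ex (random_set q1) (fun C1 : book1 => thin1 C1 k m s0 s1 u) <= cover1 u s0 s1.
Proof.
(* Membership depends on [a] only through [v1]; passing to the marginal makes the index map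
   injective, as [covering] requires. *)
rewrite /cover1 (Ex_marginal2 _ (fun v => ⟦ g1 < marginal2 (P1 u s0 s1) v ⟧)).
apply: le_trans; last first.
  apply: (@covering R q1 _ V1 (K * M1 * V1)%type _ (fun v => (k, m, v)) g1) => //; first exact: marginal2_pmf.
  by move=> v w [].
by rewrite le_eqVlt; apply/orP; left; apply/eqP/eq_Ex => C1;
  rewrite (Ex_marginal2 _ (fun v => (C1 (k, m, v))%:R)).
Qed.

Let thin2_le k m s0 s2 u :
  Ex (random_set q2) (fun C2 : book2 => thin2 C2 k m s0 s2 u) <= cover2 u s0 s2.
Proof.
rewrite /cover2 (Ex_marginal2 _ (fun v => ⟦ g2 < marginal2 (P2 u s0 s2) v ⟧)).
apply: le_trans; last first.
  apply: (@covering R q2 _ V2 (K * M2 * V2)%type _ (fun v => (k, m, v)) g2) => //; first exact: marginal2_pmf.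
  by move=> v w [].
by rewrite le_eqVlt; apply/orP; left; apply/eqP/eq_Ex => C2;
  rewrite (Ex_marginal2 _ (fun v => (C2 (k, m, v))%:R)).
Qed.

(** When a drawn sequence is outside its codebook the left side is 0; otherwise [threshold_failure]
    applies to each of the three decoders. Memberships are grouped by codebook so that [EC_prod]
    factors their average. *)
Let failure_le (C0 : book0) (C1 : book1) (C2 : book2) (k m : K) s0 u v1 v2 x1 x2 y :
  (C0 (k, u))%:R * ((C1 (k, m.1, v1))%:R * ((C2 (k, m.2, v2))%:R *
    ⟦ failure C0 C1 C2 k m u s0 x1 x2 y ⟧)) <=
  (⟦ f1 u s0 x1 v1 <= t1 ⟧ + ⟦ f2 u s0 x2 v2 <= t2 ⟧ + ⟦ f0 y (u, v1, v2) <= t0 ⟧) *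
    ((C0 (k, u))%:R * ((C1 (k, m.1, v1))%:R * (C2 (k, m.2, v2))%:R)) +
  (\sum_(m' | m' != m.1) \sum_v ⟦ t1 < f1 u s0 x1 v ⟧ *
    ((C0 (k, u))%:R * (((C1 (k, m.1, v1))%:R * (C1 (k, m', v))%:R) * (C2 (k, m.2, v2))%:R)) +
  (\sum_(m' | m' != m.2) \sum_v ⟦ t2 < f2 u s0 x2 v ⟧ *
    ((C0 (k, u))%:R * ((C1 (k, m.1, v1))%:R * ((C2 (k, m.2, v2))%:R * (C2 (k, m', v))%:R))) +
  \sum_(k' | k' != k) \sum_v ⟦ t0 < f0 y v ⟧ *
    (((C0 (k, u))%:R * (C0 (k', v.1.1))%:R) *
     (((C1 (k, m.1, v1))%:R * (C1 (k', m.1, v.1.2))%:R) *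
      ((C2 (k, m.2, v2))%:R * (C2 (k', m.2, v.2))%:R))))) :> R.
Proof.
have [C0u|] := boolP (C0 (k, u)); last first.
  move=> _ /=; rewrite !mul0r; do ?apply: addr_ge0 => //; 
  do 2 (apply: sumr_ge0 => ? _); by rewrite !mulr_ge0.
have [C1v|] := boolP (C1 (k, m.1, v1)); last first.
  move=> _ /=; rewrite !(mul0r, mulr0); do ?apply: addr_ge0 => //; 
  do 2 (apply: sumr_ge0 => ? _); by rewrite !mulr_ge0.
have [C2v|] := boolP (C2 (k, m.2, v2)); last first.
  move=> _ /=; rewrite !(mul0r, mulr0); do ?apply: addr_ge0 => //; 
  do 2 (apply: sumr_ge0 => ? _); by rewrite !mulr_ge0.
have T1 := @threshold_failure R M1 V1 (fun m v => C1 (k, m, v)) (f1 u s0 x1) t1 k.1 m.1 v1 C1v.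
have T2 := @threshold_failure R M2 V2 (fun m v => C2 (k, m, v)) (f2 u s0 x2) t2 k.2 m.2 v2 C2v.
have T0 := @threshold_failure R K _ (fun k v => [&& C0 (k, v.1.1), C1 (k, m.1, v.1.2) & C2 (k, m.2, v.2)]) (f0 y) t0 m k (u, v1, v2).
rewrite /= C0u C1v C2v in T0; have {}T0 := T0 isT.
rewrite /= !(mul1r, mulr1).
apply: (@le_trans _ _ (⟦ guess1 C1 k u s0 x1 != m.1 ⟧ + ⟦ guess2 C2 k u s0 x2 != m.2 ⟧ + ⟦ guess0 C0 C1 C2 m y != k ⟧)).
  rewrite -!natrD ler_nat /failure.
  by case: (_ != _); case: (_ != _); case: (_ != _).
have addE (a b c d e f a' b' c' : R) : a' <= a + d -> b' <= b + e -> c' <= c + f ->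
   a' + b' + c' <= a + b + c + (d + (e + f)) by lra.
apply: addE.
- apply: le_trans T1 _; rewrite lerD2l; apply: ler_sum => m' _.
  by apply: ler_sum => v _; rewrite !(mul1r, mulr1).
- apply: le_trans T2 _; rewrite lerD2l; apply: ler_sum => m' _.
  by apply: ler_sum => v _; rewrite !(mul1r, mulr1).
apply: le_trans T0 _; rewrite lerD2l; apply: ler_sum => k' _; apply: ler_sum => v _.
by rewrite !mul1r -!natrM !mulnb.
Qed.

(** Counting only wrong messages makes the term of a one-message set vanish, on which the case of
    rate 0 relies. *)
Let n1 := (#|M1|.-1)%:R : R.
Let n2 := (#|M2|.-1)%:R : R.
Let n0 := (#|{: K}|.-1)%:R : R.

Let sum_neq (T : finType) (x : T) (a : R) :
  \sum_(y | y != x) a = (#|T|.-1)%:R * a.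
Proof.
by rewrite sumr_const (cardC1 x) mulr_natl.
Qed.

Let EC_failure_le (k m : K) s0 u v1 v2 x1 x2 y :
  EC (fun C0 C1 C2 => (C0 (k, u))%:R * ((C1 (k, m.1, v1))%:R * ((C2 (k, m.2, v2))%:R *
    ⟦ failure C0 C1 C2 k m u s0 x1 x2 y ⟧))) <=
  q0 * q1 * q2 *
  (⟦ f1 u s0 x1 v1 <= t1 ⟧ + ⟦ f2 u s0 x2 v2 <= t2 ⟧ + ⟦ f0 y (u, v1, v2) <= t0 ⟧ +
   (n1 * q1 / t1 + (n2 * q2 / t2 + n0 * (q0 * q1 * q2) / t0))).
Proof.
apply: le_trans; first by apply: EC_le => C0 C1 C2; exact: failure_le.
rewrite mulrDr; rewrite ECD ECZ EC_prod !Ex_random_set1//.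
apply: lerD; first by rewrite le_eqVlt; apply/orP; left; apply/eqP; ring.
rewrite ECD.
have qq : 0 <= q0 * q1 * q2 by rewrite !mulr_ge0 ?ltW.
(* Here [a] is the probability that a wrong candidate belongs to its codebooks: [q1], [q2], or
   [q0 * q1 * q2] at the receiver. At most [1 / t] values are plausible for each wrong message. *)
have conc (M : finType) (m0 : M) (V : finType) (f : V -> R) t (a : R)
    (G : M -> V -> book0 -> book1 -> book2 -> R) : (forall v, 0 <= f v) ->
    \sum_v f v <= 1 -> 0 < t -> 0 <= a ->
    (forall m' v, m' != m0 -> EC (G m' v) = q0 * q1 * q2 * a) ->
    EC (fun C0 C1 C2 => \sum_(m' | m' != m0) \sum_v ⟦ t < f v ⟧ * G m' v C0 C1 C2) <=
    q0 * q1 * q2 * ((#|M|.-1)%:R * a / t).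
  move=> fge fle t_gt0 a0 GE; rewrite EC_sum.
  rewrite (_ : _ * (_ / t) = \sum_(m' | m' != m0) t^-1 * (q0 * q1 * q2 * a)); last first.
    by rewrite sum_neq; ring.
  apply: ler_sum => m' mm'; rewrite EC_sum.
  under eq_bigr => v _ do rewrite ECZ GE//.
  rewrite -mulr_suml; apply: ler_wpM2r; first by rewrite mulr_ge0.
  exact: sum_gt_le.
rewrite [leRHS]mulrDr; apply: lerD.
  apply: conc => // [|m' v mm']; first exact: ltW.
  rewrite (EC_prod (fun C0 => (C0 (k, u))%:R)
     (fun C1 => (C1 (k, m.1, v1))%:R * (C1 (k, m', v))%:R)
     (fun C2 => (C2 (k, m.2, v2))%:R)) !Ex_random_set1// Ex_random_set2//.
    by ring.
  by apply: contra mm' => /eqP[->].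
rewrite ECD [leRHS]mulrDr; apply: lerD.
  apply: conc => // [|m' v mm']; first exact: ltW.
  rewrite (EC_prod (fun C0 => (C0 (k, u))%:R)
     (fun C1 => (C1 (k, m.1, v1))%:R)
     (fun C2 => (C2 (k, m.2, v2))%:R * (C2 (k, m', v))%:R)) !Ex_random_set1// Ex_random_set2//.
    by ring.
  by apply: contra mm' => /eqP[->].
apply: conc => // k' v kk'.
rewrite (EC_prod (fun C0 => (C0 (k, u))%:R * (C0 (k', v.1.1))%:R)
     (fun C1 => (C1 (k, m.1, v1))%:R * (C1 (k', m.1, v.1.2))%:R)
     (fun C2 => (C2 (k, m.2, v2))%:R * (C2 (k', m.2, v.2))%:R)) !Ex_random_set2//.
- by ring.
- by apply: contra kk' => /eqP[->].
- by apply: contra kk' => /eqP[->].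
- by apply: contra kk' => /eqP[->].
Qed.

(** Each indicator of a thin codebook is multiplied only by memberships in the other codebooks,
    hence factors out under [EC]. The averaged memberships cancel the divisions by [q0], [q1], [q2]
    and leave the weights 1, 2, 4, 8. *)
Let EC_risk_le (k m : K) s0 s1 s2 u v1 v2 x1 x2 y :
  EC (fun C0 C1 C2 => risk C0 C1 C2 k m s0 s1 s2 u v1 v2 x1 x2 y) <=
  cover0 s0 + 2 * cover1 u s0 s1 + 4 * cover2 u s0 s2 + 8 *
  (⟦ f1 u s0 x1 v1 <= t1 ⟧ + ⟦ f2 u s0 x2 v2 <= t2 ⟧ + ⟦ f0 y (u, v1, v2) <= t0 ⟧ +
   (n1 * q1 / t1 + (n2 * q2 / t2 + n0 * (q0 * q1 * q2) / t0))).
Proof.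
have riskE C0 C1 C2 : risk C0 C1 C2 k m s0 s1 s2 u v1 v2 x1 x2 y =
    thin0 C0 k s0 * (1 * 1) +
    (2 / q0 * ((C0 (k, u))%:R * (thin1 C1 k m.1 s0 s1 u * 1)) +
    (4 / (q0 * q1) * ((C0 (k, u))%:R * ((C1 (k, m.1, v1))%:R * thin2 C2 k m.2 s0 s2 u)) +
    8 / (q0 * q1 * q2) * ((C0 (k, u))%:R * ((C1 (k, m.1, v1))%:R * ((C2 (k, m.2, v2))%:R *
    ⟦ failure C0 C1 C2 k m u s0 x1 x2 y ⟧))))).
  rewrite /risk; field; by rewrite !lt0r_neq0.
rewrite (_ : EC _ = EC (fun C0 C1 C2 => thin0 C0 k s0 * (1 * 1) +
    (2 / q0 * ((C0 (k, u))%:R * (thin1 C1 k m.1 s0 s1 u * 1)) +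
    (4 / (q0 * q1) * ((C0 (k, u))%:R * ((C1 (k, m.1, v1))%:R * thin2 C2 k m.2 s0 s2 u)) +
    8 / (q0 * q1 * q2) * ((C0 (k, u))%:R * ((C1 (k, m.1, v1))%:R * ((C2 (k, m.2, v2))%:R *
    ⟦ failure C0 C1 C2 k m u s0 x1 x2 y ⟧))))))); last first.
  by do 3 (apply: eq_Ex => ?); exact: riskE.
rewrite !ECD !ECZ.
rewrite (EC_prod (fun C0 => thin0 C0 k s0) (fun=> 1) (fun=> 1)).
rewrite (EC_prod (fun C0 => (C0 (k, u))%:R) (fun C1 => thin1 C1 k m.1 s0 s1 u) (fun=> 1)).
rewrite (EC_prod (fun C0 => (C0 (k, u))%:R) (fun C1 => (C1 (k, m.1, v1))%:R)
  (fun C2 => thin2 C2 k m.2 s0 s2 u)).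
rewrite !Ex_random_set1// !Ex_cst// !mulr1.
have T0 := thin0_le k s0.
have T1 := thin1_le k m.1 s0 s1 u.
have T2 := thin2_le k m.2 s0 s2 u.
have E := EC_failure_le k m s0 u v1 v2 x1 x2 y.
have add4 (a b c d a' b' c' d' : R) : a <= a' -> b <= b' -> c <= c' -> d <= d' ->
  a + (b + (c + d)) <= a' + b' + c' + d' by lra.
apply: add4 => //.
- by rewrite mulrA divfK ?lt0r_neq0//; exact: ler_wpM2l.
- rewrite !mulrA (_ : 4 / (q0 * q1) * q0 * q1 = 4); first exact: ler_wpM2l.
  by field; rewrite !lt0r_neq0.
rewrite -(ler_pM2l (x := 8 / (q0 * q1 * q2))) in E; last by rewrite divr_gt0// !mulr_gt0.
apply: le_trans E _; rewrite le_eqVlt; apply/orP; left; apply/eqP; field.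
by rewrite !lt0r_neq0.
Qed.

Definition one_shot_bound : R :=
  (4 * Ex P (fun w => ⟦ g0 < PU (rv_S0 w) (rv_U w) ⟧) + 16 * (g0 * (1 - q0) / q0)) +
  2 * (4 * Ex P (fun w =>
         ⟦ g1 < marginal2 (P1 (rv_U w) (rv_S0 w) (rv_S1 w)) (rv_V1 w) ⟧) +
       16 * (g1 * (1 - q1) / q1)) +
  4 * (4 * Ex P (fun w =>
         ⟦ g2 < marginal2 (P2 (rv_U w) (rv_S0 w) (rv_S2 w)) (rv_V2 w) ⟧) +
       16 * (g2 * (1 - q2) / q2)) +
  8 * (Ex P (fun w => ⟦ f1 (rv_U w) (rv_S0 w) (rv_X1 w) (rv_V1 w) <= t1 ⟧) +
       Ex P (fun w => ⟦ f2 (rv_U w) (rv_S0 w) (rv_X2 w) (rv_V2 w) <= t2 ⟧) +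
       Ex P (fun w => ⟦ f0 (rv_Y w) (rv_U w, rv_V1 w, rv_V2 w) <= t0 ⟧) +
       (n1 * q1 / t1 + (n2 * q2 / t2 + n0 * (q0 * q1 * q2) / t0))).

Let P_pmf : is_pmf P. Proof. exact: joint_law_pmf. Qed.

(** The law [c] is arbitrary because consecutive message pairs, padded at both ends, need not be
    uniform or independent; the averaged bound holds for every [(k, m)]. *)
Lemma one_shot (c : K * K -> R) : is_pmf c ->
  exists b, Ex c (fun km => block_error_prob b km.1 km.2) <= one_shot_bound.
Proof.
move=> hc.
suff : EC (fun C0 C1 C2 =>
    Ex (law_e0 C0) (fun e0 => Ex (law_e1 C1) (fun e1 => Ex (law_e2 C2) (fun e2 =>
    Ex c (fun km => block_error_prob (random_code C0 C1 C2 e0 e1 e2) km.1 km.2)))))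
    <= one_shot_bound.
  move=> H.
  have [C0 h0] := exists_le_Ex (fun C0 => Ex (@random_set _ _ q1) (fun C1 : book1 =>
    Ex (@random_set _ _ q2) (fun C2 : book2 =>
    Ex (law_e0 C0) (fun e0 => Ex (law_e1 C1) (fun e1 => Ex (law_e2 C2) (fun e2 =>
    Ex c (fun km => block_error_prob (random_code C0 C1 C2 e0 e1 e2) km.1 km.2))))))) r0.
  have [C1 h1] := exists_le_Ex (fun C1 =>
    Ex (@random_set _ _ q2) (fun C2 : book2 =>
    Ex (law_e0 C0) (fun e0 => Ex (law_e1 C1) (fun e1 => Ex (law_e2 C2) (fun e2 =>
    Ex c (fun km => block_error_prob (random_code C0 C1 C2 e0 e1 e2) km.1 km.2)))))) r1.
  have [C2 h2] := exists_le_Ex (fun C2 =>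
    Ex (law_e0 C0) (fun e0 => Ex (law_e1 C1) (fun e1 => Ex (law_e2 C2) (fun e2 =>
    Ex c (fun km => block_error_prob (random_code C0 C1 C2 e0 e1 e2) km.1 km.2))))) r2.
  have [e0 h3] := exists_le_Ex (fun e0 =>
    Ex (law_e1 C1) (fun e1 => Ex (law_e2 C2) (fun e2 =>
    Ex c (fun km => block_error_prob (random_code C0 C1 C2 e0 e1 e2) km.1 km.2))))
    (law_e0_pmf C0).
  have [e1 h4] := exists_le_Ex (fun e1 => Ex (law_e2 C2) (fun e2 =>
    Ex c (fun km => block_error_prob (random_code C0 C1 C2 e0 e1 e2) km.1 km.2)))
    (law_e1_pmf C1).
  have [e2 h5] := exists_le_Ex (fun e2 =>
    Ex c (fun km => block_error_prob (random_code C0 C1 C2 e0 e1 e2) km.1 km.2))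
    (law_e2_pmf C2).
  exists (random_code C0 C1 C2 e0 e1 e2).
  exact: le_trans h5 (le_trans h4 (le_trans h3 (le_trans h2 (le_trans h1 (le_trans h0 H))))).
rewrite (_ : EC _ = Ex c (fun km => EC (fun C0 C1 C2 =>
    Ex (law_e0 C0) (fun e0 => Ex (law_e1 C1) (fun e1 => Ex (law_e2 C2) (fun e2 =>
    block_error_prob (random_code C0 C1 C2 e0 e1 e2) km.1 km.2)))))); last first.
  rewrite -EC_Ex; do 3 (apply: eq_Ex => ?).
  rewrite [RHS]ExC; apply: eq_Ex => e0; rewrite [RHS]ExC; apply: eq_Ex => e1.
  by rewrite [RHS]ExC.
rewrite -[leRHS](Ex_cst _ hc); apply: Ex_le => // -[k m] /=.
apply: le_trans.
  by apply: EC_le => C0 C1 C2; exact: random_code_error_le.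
rewrite EC_Ex.
apply: (@le_trans _ _ (Ex P (fun w => 
  cover0 (rv_S0 w) + 2 * cover1 (rv_U w) (rv_S0 w) (rv_S1 w) +
  4 * cover2 (rv_U w) (rv_S0 w) (rv_S2 w) + 8 *
  (⟦ f1 (rv_U w) (rv_S0 w) (rv_X1 w) (rv_V1 w) <= t1 ⟧ +
   ⟦ f2 (rv_U w) (rv_S0 w) (rv_X2 w) (rv_V2 w) <= t2 ⟧ +
   ⟦ f0 (rv_Y w) (rv_U w, rv_V1 w, rv_V2 w) <= t0 ⟧ +
   (n1 * q1 / t1 + (n2 * q2 / t2 + n0 * (q0 * q1 * q2) / t0)))))).
  by apply: Ex_le => // -[[[[[[[[s0 s1] s2] u] v1] v2] x1] x2] y]; exact: EC_risk_le.
rewrite !(ExD, ExZ) !(Ex_cst _ P_pmf) /one_shot_bound.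
(* The covering terms redraw [u], [v1], [v2] from their conditional laws; under [P] the second draw
   has the law of the first. *)
have -> : Ex P (fun w => Ex (PU (rv_S0 w)) (fun u => ⟦ g0 < PU (rv_S0 w) u ⟧)) =
    Ex P (fun w => ⟦ g0 < PU (rv_S0 w) (rv_U w) ⟧).
  rewrite !Ex_joint_law /=; apply: eq_Ex => s0; apply: eq_Ex => s1; apply: eq_Ex => s2.
  under [RHS]eq_Ex => u do rewrite (Ex_from_X1V1 hW hP1 hP2).
  by rewrite -[RHS](Ex_cst _ (hPU s0)); apply: eq_Ex => u; exact: (Ex_from_X1V1 hW hP1 hP2).
have -> : Ex P (fun w => Ex (P1 (rv_U w) (rv_S0 w) (rv_S1 w)) (fun a =>
      ⟦ g1 < marginal2 (P1 (rv_U w) (rv_S0 w) (rv_S1 w)) a.2 ⟧)) =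
    Ex P (fun w => ⟦ g1 < marginal2 (P1 (rv_U w) (rv_S0 w) (rv_S1 w)) (rv_V1 w) ⟧).
  rewrite !Ex_joint_law /=; apply: eq_Ex => s0; apply: eq_Ex => s1; apply: eq_Ex => s2.
  apply: eq_Ex => u; under [RHS]eq_Ex => a do rewrite (Ex_from_X2V2 hW hP2).
  exact: (Ex_from_X1V1 hW hP1 hP2).
have -> : Ex P (fun w => Ex (P2 (rv_U w) (rv_S0 w) (rv_S2 w)) (fun a =>
      ⟦ g2 < marginal2 (P2 (rv_U w) (rv_S0 w) (rv_S2 w)) a.2 ⟧)) =
    Ex P (fun w => ⟦ g2 < marginal2 (P2 (rv_U w) (rv_S0 w) (rv_S2 w)) (rv_V2 w) ⟧).
  rewrite !Ex_joint_law /=; apply: eq_Ex => s0; apply: eq_Ex => s1; apply: eq_Ex => s2.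
  apply: eq_Ex => u; rewrite (Ex_from_X1V1 hW hP1 hP2) -[LHS](Ex_cst _ (hP1 u s0 s1)).
  by apply: eq_Ex => a; apply: eq_Ex => b; rewrite Ex_cst.
by [].
Qed.

End OneShot.

(** * Product laws and the law of large numbers *)

Section LargeNumbers.
Context {R : realType}.

Let l2_gt0 : 0 < ln 2 :> R. Proof. by rewrite ln_gt0// ltr1n. Qed.

Lemma log2_powR (x : R) : log2 (2 `^ x) = x.
Proof. by rewrite /log2 ln_powR mulfK// lt0r_neq0. Qed.

Lemma log2M (x y : R) : 0 < x -> 0 < y -> log2 (x * y) = log2 x + log2 y.
Proof. by move=> x0 y0; rewrite /log2 lnM ?posrE// mulrDl. Qed.

Lemma log2_div (x y : R) : 0 < x -> 0 < y -> log2 (x / y) = log2 x - log2 y.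
Proof. by move=> x0 y0; rewrite /log2 ln_div ?posrE// mulrBl. Qed.

Lemma log2_prod (I : finType) (F : I -> R) :
  (forall i, 0 < F i) -> log2 (\prod_i F i) = \sum_i log2 (F i).
Proof.
move=> F0; suff [] : log2 (\prod_i F i) = \sum_i log2 (F i) /\ 0 < \prod_i F i by [].
elim/big_rec2 : _ => [|i y x _ [<- x0]]; first by rewrite /log2 ln1 mul0r.
by rewrite log2M// mulr_gt0.
Qed.

Lemma ler_log2 (x y : R) : 0 < x -> x <= y -> log2 x <= log2 y.
Proof.
move=> x0 xy; rewrite /log2 ler_pM2r ?invr_gt0// ler_ln// posrE//.
exact: lt_le_trans xy.
Qed.

(** Trades exponential decay for [1 / n], the speed that Chebyshev gives for the other error terms
    anyway. *)
Lemma pow2N_le (n : nat) (d : R) : (0 < n)%N -> 0 < d ->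
  2 `^ (- (n%:R * d)) <= (d * ln 2)^-1 / n%:R.
Proof.
move=> n0 d0; rewrite powRN -invfM lef_pV2 ?posrE ?powR_gt0// ?mulr_gt0 ?ltr0n//.
rewrite /powR pnatr_eq0/=; apply: le_trans (expR_ge1Dx _).
by rewrite mulrC mulrA ler_wpDl.
Qed.

Variables (T : finType) (p : T -> R) (hp : is_pmf p).

Lemma chebyshev_sum (n : nat) (h : T -> R) (d : R) :
  (0 < n)%N -> 0 < d -> Ex p h = 0 ->
  Ex (prodp (fun _ : 'I_n => p)) (fun f => ⟦ n%:R * d <= `|\sum_i h (f i)| ⟧) <=
    Ex p (fun x => h x ^+ 2) / (d ^+ 2) / n%:R.
Proof.
move=> n0 d0 h0; have hpn : is_pmf (prodp (fun _ : 'I_n => p)) by exact: prodp_pmf.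
have nd0 : 0 < n%:R * d by rewrite mulr_gt0// ltr0n.
apply: (@le_trans _ _ (Ex (prodp (fun _ : 'I_n => p))
    (fun f => (n%:R * d) ^- 2 * (\sum_i h (f i)) ^+ 2))).
  apply: Ex_le => // f; case: (leP (n%:R * d)) => [le|_]; last first.
    by rewrite mulr_ge0 ?sqr_ge0// invr_ge0 sqr_ge0.
  rewrite mulrC ler_pdivlMr ?exprn_gt0// mul1r -[leRHS]real_normK ?num_real//.
  by rewrite lerXn2r ?nnegrE// ltW.
rewrite ExZ.
have -> : Ex (prodp (fun _ : 'I_n => p)) (fun f => (\sum_i h (f i)) ^+ 2) =
    n%:R * Ex p (fun x => h x ^+ 2).
  transitivity (Ex (prodp (fun _ : 'I_n => p)) (fun f => \sum_i \sum_j h (f i) * h (f j))).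
    by apply: eq_Ex => f; rewrite expr2 mulr_suml; apply: eq_bigr => i _; rewrite mulr_sumr.
  rewrite Ex_sum -[X in X%:R * _](card_ord n) mulr_natl -sumr_const.
  apply: eq_bigr => i _; rewrite Ex_sum (bigD1 i)//= big1 ?addr0 => [|j ji].
    by rewrite (Ex_prodp1 i (fun x => h x * h x)).
  by rewrite (Ex_prodp2 h h _ (i := i)) ?h0 ?mul0r// eq_sym.
rewrite le_eqVlt; apply/orP; left; apply/eqP; field.
by rewrite !lt0r_neq0// ltr0n.
Qed.

Variables (r : T -> R) (r_gt0 : forall x, 0 < p x -> 0 < r x).
Let e := Ex p (fun x => log2 (r x)).
Let v := Ex p (fun x => (log2 (r x) - e) ^+ 2).

Let centered : Ex p (fun x => log2 (r x) - e) = 0.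
Proof. by rewrite ExB Ex_cst// subrr. Qed.

(** Restricted to the support, since [r] may vanish elsewhere and the logarithm of the product would
    not split. *)
Let log2_prod_supp n (f : {ffun 'I_n -> T}) : 0 < prodp (fun=> p) f ->
  0 < \prod_i r (f i) /\ log2 (\prod_i r (f i)) = n%:R * e + \sum_i (log2 (r (f i)) - e).
Proof.
move=> pf; have {pf} : forall i, 0 < r (f i).
  move=> i; apply: r_gt0; rewrite lt_neqAle; have [p0 _] := hp.
  rewrite p0 andbT; apply/negP => /eqP pi0.
  by move: pf; rewrite /prodp (bigD1 i)//= -pi0 mul0r ltxx.
move=> rf; split; first by apply: prodr_gt0.
rewrite log2_prod// sumrB sumr_const card_ord; ring.
Qed.

(** With [prod_le_unlikely], the two sides of asymptotic equipartition for a likelihood [r] of mean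
    logarithm [e]. *)
Lemma prod_gt_unlikely n d : (0 < n)%N -> 0 < d ->
  Ex (prodp (fun _ : 'I_n => p)) (fun f => ⟦ 2 `^ (n%:R * (e + d)) < \prod_i r (f i) ⟧) <=
    v / (d ^+ 2) / n%:R.
Proof.
move=> n0 d0; apply: le_trans (chebyshev_sum n0 d0 centered).
apply: Ex_le_supp => [|f /log2_prod_supp[r0 rE]]; first exact: prodp_pmf.
case: ltP => // /ltW /(ler_log2 (powR_gt0 _ _)) => /(_ (ltr0n _ 2)).
rewrite log2_powR rE mulrDr lerD2l => le.
by rewrite (le_trans le)// ler_norm.
Qed.

Lemma prod_le_unlikely n d : (0 < n)%N -> 0 < d ->
  Ex (prodp (fun _ : 'I_n => p)) (fun f => ⟦ \prod_i r (f i) <= 2 `^ (n%:R * (e - d)) ⟧) <=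
    v / (d ^+ 2) / n%:R.
Proof.
move=> n0 d0; apply: le_trans (chebyshev_sum n0 d0 centered).
apply: Ex_le_supp => [|f /log2_prod_supp[r0 rE]]; first exact: prodp_pmf.
case: (leP (\prod_i r (f i))) => // /(ler_log2 r0).
rewrite log2_powR rE mulrDr mulrN lerD2l -lerNr => le.
by rewrite (le_trans le)// -normrN ler_norm.
Qed.

End LargeNumbers.

(** * Product laws on tuples *)

Section Tuples.
Context {R : realType}.

Definition tprod n (T : finType) (P : 'I_n -> T -> R) (t : n.-tuple T) : R :=
  \prod_i P i (tnth t i).

Lemma sum_tuple n (T : finType) (F : n.-tuple T -> R) :
  \sum_t F t = \sum_(f : {ffun 'I_n -> T}) F [tuple f i | i < n].
Proof.
rewrite (reindex (fun f : {ffun 'I_n -> T} => [tuple f i | i < n]))//.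
exists (fun t => [ffun i => tnth t i]) => [f|t] _.
  by apply/ffunP => i; rewrite ffunE tnth_mktuple.
by apply: eq_from_tnth => i; rewrite tnth_mktuple ffunE.
Qed.

Lemma Ex_tprod n (T : finType) (P : 'I_n -> T -> R) F :
  Ex (tprod P) F = Ex (prodp P) (fun f => F [tuple f i | i < n]).
Proof.
rewrite /Ex sum_tuple; apply: eq_bigr => f _; congr (_ * _).
by apply: eq_bigr => i _; rewrite tnth_mktuple.
Qed.

Lemma sum_tprod n (T : finType) (P : 'I_n -> T -> R) :
  \sum_t tprod P t = \prod_i \sum_x P i x.
Proof.
rewrite sum_tuple bigA_distr_bigA; apply: eq_bigr => f _.
by apply: eq_bigr => i _; rewrite tnth_mktuple.
Qed.

Lemma tprod_pmf n (T : finType) (P : 'I_n -> T -> R) :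
  (forall i, is_pmf (P i)) -> is_pmf (tprod P).
Proof.
move=> hP; split=> [t|]; first by apply: prodr_ge0 => i _; case: (hP i).
by rewrite sum_tprod big1// => i _; case: (hP i).
Qed.

Lemma Ex_tprod_inj n l (T : finType) (P : 'I_n -> T -> R) (h : 'I_l -> 'I_n) F :
  (forall i, is_pmf (P i)) -> injective h ->
  Ex (tprod P) (fun t => F [tuple tnth t (h i) | i < l]) = Ex (tprod (P \o h)) F.
Proof.
move=> hP hinj; rewrite !Ex_tprod.
rewrite -(Ex_prodp_inj (fun g => F [tuple g i | i < l]) hP hinj).
apply: eq_Ex => f; congr F; apply: eq_from_tnth => i.
by rewrite !tnth_mktuple ffunE.
Qed.

End Tuples.

(** * Coding for one long block *)

Section BlockLaw.
Context {R : realType} {X1 X2 S0 S1 S2 Y U V1 V2 : finType}.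
Variables (PS0 : S0 -> R) (PS1 : S1 -> R) (PS2 : S2 -> R).
Variables (W : X1 -> X2 -> S0 -> S1 -> S2 -> Y -> R).
Variables (PU : S0 -> U -> R) (P1 : U -> S0 -> S1 -> X1 * V1 -> R).
Variables (P2 : U -> S0 -> S2 -> X2 * V2 -> R).
Variable n : nat.

Definition iid (T : finType) (p : T -> R) : n.-tuple T -> R := tprod (fun=> p).

Definition channel_tuple (x1 : n.-tuple X1) (x2 : n.-tuple X2)
    (s0 : n.-tuple S0) (s1 : n.-tuple S1) (s2 : n.-tuple S2) : n.-tuple Y -> R :=
  tprod (fun i => W (tnth x1 i) (tnth x2 i) (tnth s0 i) (tnth s1 i) (tnth s2 i)).

Definition PU_tuple (s0 : n.-tuple S0) : n.-tuple U -> R :=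
  tprod (fun i => PU (tnth s0 i)).

(** A law on pairs of tuples rather than on tuples of pairs, the shape that the one-block result
    expects with tuples as letters. *)
Definition XV_tuple (S X V : finType) (Q : U -> S0 -> S -> X * V -> R)
    (u : n.-tuple U) (s0 : n.-tuple S0) (s : n.-tuple S)
    (a : n.-tuple X * n.-tuple V) : R :=
  \prod_i Q (tnth u i) (tnth s0 i) (tnth s i) (tnth a.1 i, tnth a.2 i).

Lemma marginal2_XV_tuple (S X V : finType) (Q : U -> S0 -> S -> X * V -> R) u s0 s :
  marginal2 (XV_tuple Q u s0 s) =
  tprod (fun i => marginal2 (Q (tnth u i) (tnth s0 i) (tnth s i))).
Proof.
apply/funext => v; rewrite /marginal2 /XV_tuple /=.
exact: (sum_tprod (fun i x => Q (tnth u i) (tnth s0 i) (tnth s i) (x, tnth v i))).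
Qed.

Lemma XV_tuple_pmf (S X V : finType) (Q : U -> S0 -> S -> X * V -> R) u s0 s :
  (forall u s0 s, is_pmf (Q u s0 s)) -> is_pmf (XV_tuple Q u s0 s).
Proof.
move=> hQ; split=> [a|]; first by apply: prodr_ge0 => i _; case: (hQ (tnth u i) (tnth s0 i) (tnth s i)).
transitivity (Ex (XV_tuple Q u s0 s) (fun=> 1)).
  by apply: eq_bigr => a _; rewrite mulr1.
rewrite (Ex_marginal2 _ (fun=> 1)) marginal2_XV_tuple Ex_cst//.
by apply: tprod_pmf => i; exact: marginal2_pmf.
Qed.

Definition unzip_outcome (f : {ffun 'I_n -> @outcome X1 X2 S0 S1 S2 Y U V1 V2}) :
    @outcome (n.-tuple X1) (n.-tuple X2) (n.-tuple S0) (n.-tuple S1) (n.-tuple S2)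
             (n.-tuple Y) (n.-tuple U) (n.-tuple V1) (n.-tuple V2) :=
  ([tuple rv_S0 (f i) | i < n], [tuple rv_S1 (f i) | i < n],
   [tuple rv_S2 (f i) | i < n], [tuple rv_U (f i) | i < n],
   [tuple rv_V1 (f i) | i < n], [tuple rv_V2 (f i) | i < n],
   [tuple rv_X1 (f i) | i < n], [tuple rv_X2 (f i) | i < n],
   [tuple rv_Y (f i) | i < n]).

(** The joint law over tuple alphabets is a product of single-letter laws after regrouping; this
    opens the one-block bound to the law of large numbers. *)
Lemma Ex_joint_tuple F :
  Ex (joint_law (iid PS0) (iid PS1) (iid PS2) channel_tuple PU_tuple
        (XV_tuple P1) (XV_tuple P2)) F =
  Ex (prodp (fun _ : 'I_n => joint_law PS0 PS1 PS2 W PU P1 P2))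
    (fun f => F (unzip_outcome f)).
Proof.
rewrite /Ex (reindex unzip_outcome)/=.
  apply: eq_bigr => f _; congr (_ * _).
  rewrite /iid /channel_tuple /PU_tuple /XV_tuple /tprod /= -!big_split /=.
  apply: eq_bigr => i _; rewrite !tnth_mktuple.
  by case: (f i) => -[[[[[[[? ?] ?] ?] ?] ?] ?] ?] ?.
exists (fun w => [ffun i => (tnth (rv_S0 w) i, tnth (rv_S1 w) i, tnth (rv_S2 w) i,
  tnth (rv_U w) i, tnth (rv_V1 w) i, tnth (rv_V2 w) i, tnth (rv_X1 w) i,
  tnth (rv_X2 w) i, tnth (rv_Y w) i)]) => [f|w] _.
  apply/ffunP => i; rewrite ffunE /= !tnth_mktuple.
  by case: (f i) => -[[[[[[[? ?] ?] ?] ?] ?] ?] ?] ?.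
case: w => -[[[[[[[s0 s1] s2] u] v1] v2] x1] x2] y.
rewrite /unzip_outcome; do ![congr (_, _)];
  by apply: eq_from_tnth => i; rewrite tnth_mktuple ffunE.
Qed.

End BlockLaw.

(** * The one-block bound with exponential parameters *)

Section BlockCoding.
Context {R : realType} {X1 X2 S0 S1 S2 Y U V1 V2 : finType}.
Variables (PS0 : S0 -> R) (PS1 : S1 -> R) (PS2 : S2 -> R).
Variables (W : X1 -> X2 -> S0 -> S1 -> S2 -> Y -> R).
Variables (PU : S0 -> U -> R) (P1 : U -> S0 -> S1 -> X1 * V1 -> R).
Variables (P2 : U -> S0 -> S2 -> X2 * V2 -> R).
Hypotheses (hPS0 : is_pmf PS0) (hPS1 : is_pmf PS1) (hPS2 : is_pmf PS2).
Hypothesis hW : forall x1 x2 s0 s1 s2, is_pmf (W x1 x2 s0 s1 s2).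
Hypothesis hPU : forall s0, is_pmf (PU s0).
Hypothesis hP1 : forall u s0 s1, is_pmf (P1 u s0 s1).
Hypothesis hP2 : forall u s0 s2, is_pmf (P2 u s0 s2).

Local Notation P := (joint_law PS0 PS1 PS2 W PU P1 P2).

Variables (f1 : U -> S0 -> X1 -> V1 -> R) (f2 : U -> S0 -> X2 -> V2 -> R).
Variable (f0 : Y -> U * V1 * V2 -> R).
Hypotheses (f0_ge0 : forall y v, 0 <= f0 y v) (f0_le1 : forall y, \sum_v f0 y v <= 1).
Hypotheses (f1_ge0 : forall u s0 x v, 0 <= f1 u s0 x v)
  (f1_le1 : forall u s0 x, \sum_v f1 u s0 x v <= 1).
Hypotheses (f2_ge0 : forall u s0 x v, 0 <= f2 u s0 x v)
  (f2_le1 : forall u s0 x, \sum_v f2 u s0 x v <= 1).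
Hypothesis f0_gt0 : forall w, 0 < P w -> 0 < f0 (rv_Y w) (rv_U w, rv_V1 w, rv_V2 w).
Hypothesis f1_gt0 : forall w, 0 < P w -> 0 < f1 (rv_U w) (rv_S0 w) (rv_X1 w) (rv_V1 w).
Hypothesis f2_gt0 : forall w, 0 < P w -> 0 < f2 (rv_U w) (rv_S0 w) (rv_X2 w) (rv_V2 w).

(* These are minus the conditional entropies H(U|S0), H(V1|U,S0,S1), H(V2|U,S0,S2)
   and, for posterior scores, H(U,V1,V2|Y), H(V1|U,S0,X1), H(V2|U,S0,X2). *)
Let e0 := Ex P (fun w => log2 (PU (rv_S0 w) (rv_U w))).
Let e1 := Ex P (fun w => log2 (marginal2 (P1 (rv_U w) (rv_S0 w) (rv_S1 w)) (rv_V1 w))).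
Let e2 := Ex P (fun w => log2 (marginal2 (P2 (rv_U w) (rv_S0 w) (rv_S2 w)) (rv_V2 w))).
Let l0 := Ex P (fun w => log2 (f0 (rv_Y w) (rv_U w, rv_V1 w, rv_V2 w))).
Let l1 := Ex P (fun w => log2 (f1 (rv_U w) (rv_S0 w) (rv_X1 w) (rv_V1 w))).
Let l2 := Ex P (fun w => log2 (f2 (rv_U w) (rv_S0 w) (rv_X2 w) (rv_V2 w))).

Let P_pmf : is_pmf P. Proof. exact: joint_law_pmf. Qed.

Let f1n n (u : n.-tuple U) s0 x (v : n.-tuple V1) : R :=
  \prod_i f1 (tnth u i) (tnth s0 i) (tnth x i) (tnth v i).
Let f2n n (u : n.-tuple U) s0 x (v : n.-tuple V2) : R :=
  \prod_i f2 (tnth u i) (tnth s0 i) (tnth x i) (tnth v i).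
Let f0n n (y : n.-tuple Y) (v : n.-tuple U * n.-tuple V1 * n.-tuple V2) : R :=
  \prod_i f0 (tnth y i) (tnth v.1.1 i, tnth v.1.2 i, tnth v.2 i).

Let f1n_ge0 n u s0 x v : 0 <= @f1n n u s0 x v.
Proof. by apply: prodr_ge0. Qed.

Let f1n_le1 n u s0 x : \sum_v @f1n n u s0 x v <= 1.
Proof.
rewrite (sum_tprod (fun i v => f1 (tnth u i) (tnth s0 i) (tnth x i) v)).
by apply: Num.Theory.prodr_ile1 => i _; rewrite sumr_ge0//=.
Qed.

Let f2n_ge0 n u s0 x v : 0 <= @f2n n u s0 x v.
Proof. by apply: prodr_ge0. Qed.

Let f2n_le1 n u s0 x : \sum_v @f2n n u s0 x v <= 1.
Proof.
rewrite (sum_tprod (fun i v => f2 (tnth u i) (tnth s0 i) (tnth x i) v)).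
by apply: Num.Theory.prodr_ile1 => i _; rewrite sumr_ge0//=.
Qed.

Let f0n_ge0 n y v : 0 <= @f0n n y v.
Proof. by apply: prodr_ge0. Qed.

Let f0n_le1 n y : \sum_v @f0n n y v <= 1.
Proof.
have -> : \sum_v @f0n n y v = \prod_i \sum_v f0 (tnth y i) v.
  have sum_triple (A B C : finType) (F : A * B * C -> R) :
      \sum_v F v = \sum_a \sum_b \sum_c F (a, b, c).
    rewrite pair_bigA (pair_bigA _ (fun ab c => F (ab.1, ab.2, c))).
    by apply: eq_bigr => -[[]].
  rewrite sum_triple.
  under [RHS]eq_bigr => i _ do rewrite sum_triple.
  rewrite -(sum_tprod (fun i u => \sum_v1 \sum_v2 f0 (tnth y i) (u, v1, v2))).
  apply: eq_bigr => u _; rewrite /tprod.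
  rewrite -(sum_tprod (fun i v1 => \sum_v2 f0 (tnth y i) (tnth u i, v1, v2))).
  apply: eq_bigr => v1 _; rewrite /tprod.
  by rewrite -(sum_tprod (fun i v2 => f0 (tnth y i) (tnth u i, tnth v1 i, v2))).
by apply: Num.Theory.prodr_ile1 => i _; rewrite sumr_ge0//=.
Qed.

(** The constant [A] absorbs the rounding of message sets, and [D] depends on neither [n] nor those
    sets. When [r1 = 0] there is no wrong message, so no gap between [l1] and [e1] is required. *)
Lemma block_coding (r1 r2 A : R) :
  0 <= r1 -> 0 <= r2 -> 0 <= A ->
  r1 = 0 \/ r1 < l1 - e1 -> r2 = 0 \/ r2 < l2 - e2 ->
  (r1 = 0 /\ r2 = 0) \/ r1 + r2 < l0 - e0 - e1 - e2 ->
  exists D : R, forall (n : nat) (M1 M2 : finType) (c : (M1 * M2) * (M1 * M2) -> R),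
    (0 < n)%N -> is_pmf c ->
    (r1 = 0 -> #|M1| = 1%N) -> (r2 = 0 -> #|M2| = 1%N) ->
    #|M1|%:R <= A * 2 `^ (n%:R * r1) -> #|M2|%:R <= A * 2 `^ (n%:R * r2) ->
    exists b, Ex c (fun km => block_error_prob (@iid _ n _ PS0) (@iid _ n _ PS1) (@iid _ n _ PS2)
      (@channel_tuple _ _ _ _ _ _ _ W n) b km.1 km.2) <= D / n%:R.
Proof.
move=> r1_ge0 r2_ge0 A_ge0 hr1 hr2 hr0.
(* Each inclusion probability costs [2 * d], the decoding threshold costs [d], and [d] must remain
   as exponent of decay: [4 = 2 + 1 + 1] for one codebook, [8 = 3 * 2 + 1 + 1] for three. *)
have [d [d_gt0 hd1 hd2 hd0]] : exists d : R, [/\ 0 < d, r1 = 0 \/ r1 + 4 * d <= l1 - e1,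
    r2 = 0 \/ r2 + 4 * d <= l2 - e2 &
    (r1 = 0 /\ r2 = 0) \/ r1 + r2 + 8 * d <= l0 - e0 - e1 - e2].
  have slack (Q : Prop) (x y k : R) : 0 < k -> Q \/ x < y ->
      exists2 d, 0 < d & forall d', d' <= d -> Q \/ x + k * d' <= y.
    move=> k0 [hQ|xy]; first by exists 1 => // d' _; left.
    exists ((y - x) / k); first by rewrite divr_gt0// subr_gt0.
    by move=> d'; rewrite ler_pdivlMr// => hd; right; lra.
  have [a a0 ha] := slack _ _ _ 4 (ltr0n _ 4) hr1.
  have [b b0 hb] := slack _ _ _ 4 (ltr0n _ 4) hr2.
  have [c c0 hc] := slack _ _ _ 8 (ltr0n _ 8) hr0.
  exists (Num.min a (Num.min b c)); split.
  - by rewrite !lt_min a0 b0 c0.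
  - by apply: ha; rewrite ge_min lexx.
  - by apply: hb; rewrite !ge_min lexx orbT.
  - by apply: hc; rewrite !ge_min lexx !orbT.
pose var (r : _ -> R) := Ex P (fun w => (log2 (r w) - Ex P (fun w => log2 (r w))) ^+ 2) / d ^+ 2.
pose k := (d * ln 2)^-1.
have k_ge0 : 0 <= k by rewrite invr_ge0 mulr_ge0 ?ltW// ln_gt0// ltr1n.
pose B0 := var (fun w => PU (rv_S0 w) (rv_U w)).
pose B1 := var (fun w => marginal2 (P1 (rv_U w) (rv_S0 w) (rv_S1 w)) (rv_V1 w)).
pose B2 := var (fun w => marginal2 (P2 (rv_U w) (rv_S0 w) (rv_S2 w)) (rv_V2 w)).
pose C0 := var (fun w => f0 (rv_Y w) (rv_U w, rv_V1 w, rv_V2 w)).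
pose C1 := var (fun w => f1 (rv_U w) (rv_S0 w) (rv_X1 w) (rv_V1 w)).
pose C2 := var (fun w => f2 (rv_U w) (rv_S0 w) (rv_X2 w) (rv_V2 w)).
exists ((4 * B0 + 16 * k) + 2 * (4 * B1 + 16 * k) + 4 * (4 * B2 + 16 * k) +
  8 * (C1 + C2 + C0 + (A * k + (A * k + A ^+ 2 * k)))).
move=> n M1 M2 c n_gt0 hc M1_1 M2_1 M1_le M2_le.
pose pow x : R := 2 `^ (n%:R * x).
have pow_gt0 x : 0 < pow x by rewrite powR_gt0.
have powD x y : pow (x + y) = pow x * pow y.
  by rewrite /pow mulrDr powRD// pnatr_eq0 implybT.
have pow_le x y : x <= y -> pow x <= pow y.
  by move=> xy; rewrite ler_powR ?ler1n// ler_wpM2l.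
have powN_le : pow (- d) <= k / n%:R by rewrite /pow mulrN; exact: pow2N_le.
(* The gap [d] above the truncation level [pow (e + d)] makes the covering term decay. At the cap 1
   the codebook keeps everything, and the factor [1 - q e] cancels that term. *)
pose q e := Num.min 1 (pow (e + 2 * d)).
have q01 e : 0 < q e <= 1 by rewrite lt_min ltr01 pow_gt0 ge_min lexx.
have q_le e : q e <= pow (e + 2 * d) by rewrite ge_min lexx orbT.
have cover_le e : pow (e + d) * (1 - q e) / q e <= k / n%:R.
  apply: le_trans powN_le; rewrite /q; case: (leP 1) => h.
    by rewrite subrr mulr0 mul0r ltW.
  rewrite ler_pdivrMr// -powD (_ : - d + _ = e + d); last by ring.
  rewrite -[leRHS]mulr1; apply: ler_wpM2l; first exact: ltW.
  by rewrite gerBl ltW.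
have pack_le (x B a b c' z : R) : 0 <= x -> 0 <= z -> 0 <= B -> x <= B * pow a -> z <= pow b ->
    a + b - c' <= - d -> x * z / pow c' <= B * k / n%:R.
  move=> x0 z0 B0' xle zle abc.
  rewrite ler_pdivrMr//.
  apply: (@le_trans _ _ (B * pow (a + b))).
    by rewrite powD mulrA ler_pM.
  rewrite -!mulrA ler_wpM2l//.
  apply: (@le_trans _ _ (pow (- d) * pow c')).
    by rewrite -powD pow_le//; lra.
  by rewrite mulrA ler_wpM2r// ltW.
have [b hb] := @one_shot R _ _ _ _ _ _ _ _ _ M1 M2 (@iid _ n _ PS0) (@iid _ n _ PS1)
  (@iid _ n _ PS2) (@channel_tuple _ _ _ _ _ _ _ W n) (@PU_tuple _ _ _ PU n)
  (@XV_tuple _ _ _ n _ _ _ P1) (@XV_tuple _ _ _ n _ _ _ P2)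
  (tprod_pmf (fun=> hPS0)) (tprod_pmf (fun=> hPS1)) (tprod_pmf (fun=> hPS2))
  (fun _ _ _ _ _ => tprod_pmf (fun=> hW _ _ _ _ _))
  (fun _ => tprod_pmf (fun=> hPU _))
  (fun u s0 s1 => XV_tuple_pmf u s0 s1 hP1) (fun u s0 s2 => XV_tuple_pmf u s0 s2 hP2)
  (@f1n n) (@f2n n) (@f0n n) (q e0) (q e1) (q e2)
  (pow (l0 - d)) (pow (l1 - d)) (pow (l2 - d)) (pow (e0 + d)) (pow (e1 + d)) (pow (e2 + d))
  (q01 _) (q01 _) (q01 _) (ltW (pow_gt0 _)) (ltW (pow_gt0 _)) (ltW (pow_gt0 _))
  (pow_gt0 _) (pow_gt0 _) (pow_gt0 _)
  (@f0n_ge0 n) (@f0n_le1 n)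
  (@f1n_ge0 n) (@f1n_le1 n)
  (@f2n_ge0 n) (@f2n_le1 n) c hc.
exists b; apply: le_trans hb _; rewrite /one_shot_bound.
have lln_gt (r : _ -> R) e F : (forall w, 0 < P w -> 0 < r w) ->
    e = Ex P (fun w => log2 (r w)) ->
    (forall f, F (unzip_outcome f) = \prod_(i < n) r (f i)) ->
    Ex (joint_law (iid PS0) (iid PS1) (iid PS2) (@channel_tuple _ _ _ _ _ _ _ W n)
        (@PU_tuple _ _ _ PU n) (@XV_tuple _ _ _ n _ _ _ P1) (@XV_tuple _ _ _ n _ _ _ P2)) (fun w => ⟦ pow (e + d) < F w ⟧) <= var r / n%:R.
  move=> r_gt0 -> FE; rewrite Ex_joint_tuple.
  apply: le_trans (prod_gt_unlikely P_pmf r_gt0 n_gt0 d_gt0).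
  by apply: Ex_le => [|f]; [exact: prodp_pmf|rewrite FE].
have lln_le (r : _ -> R) e F : (forall w, 0 < P w -> 0 < r w) ->
    e = Ex P (fun w => log2 (r w)) ->
    (forall f, F (unzip_outcome f) = \prod_(i < n) r (f i)) ->
    Ex (joint_law (iid PS0) (iid PS1) (iid PS2) (@channel_tuple _ _ _ _ _ _ _ W n)
        (@PU_tuple _ _ _ PU n) (@XV_tuple _ _ _ n _ _ _ P1) (@XV_tuple _ _ _ n _ _ _ P2)) (fun w => ⟦ F w <= pow (e - d) ⟧) <= var r / n%:R.
  move=> r_gt0 -> FE; rewrite Ex_joint_tuple.
  apply: le_trans (prod_le_unlikely P_pmf r_gt0 n_gt0 d_gt0).
  by apply: Ex_le => [|f]; [exact: prodp_pmf|rewrite FE].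
have H0 := lln_gt (fun w => PU (rv_S0 w) (rv_U w)) e0
  (fun w => @PU_tuple _ _ _ PU n (rv_S0 w) (rv_U w)) _ erefl _.
have H1 := lln_gt (fun w => marginal2 (P1 (rv_U w) (rv_S0 w) (rv_S1 w)) (rv_V1 w)) e1
  (fun w => marginal2 (@XV_tuple _ _ _ n _ _ _ P1 (rv_U w) (rv_S0 w) (rv_S1 w)) (rv_V1 w)) _ erefl _.
have H2 := lln_gt (fun w => marginal2 (P2 (rv_U w) (rv_S0 w) (rv_S2 w)) (rv_V2 w)) e2
  (fun w => marginal2 (@XV_tuple _ _ _ n _ _ _ P2 (rv_U w) (rv_S0 w) (rv_S2 w)) (rv_V2 w)) _ erefl _.
have G0 := lln_le (fun w => f0 (rv_Y w) (rv_U w, rv_V1 w, rv_V2 w)) l0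
  (fun w => f0n (rv_Y w) (rv_U w, rv_V1 w, rv_V2 w)) f0_gt0 erefl _.
have G1 := lln_le (fun w => f1 (rv_U w) (rv_S0 w) (rv_X1 w) (rv_V1 w)) l1
  (fun w => f1n (rv_U w) (rv_S0 w) (rv_X1 w) (rv_V1 w)) f1_gt0 erefl _.
have G2 := lln_le (fun w => f2 (rv_U w) (rv_S0 w) (rv_X2 w) (rv_V2 w)) l2
  (fun w => f2n (rv_U w) (rv_S0 w) (rv_X2 w) (rv_V2 w)) f2_gt0 erefl _.
have nV : 0 <= (n%:R)^-1 :> R by rewrite invr_ge0.
have q_ge0 e : 0 <= q e by case/andP: (q01 e) => /ltW.
have pred_le (m : nat) : (m.-1)%:R <= m%:R :> R by rewrite ler_nat leq_pred.
have J1 : (#|M1|.-1)%:R * q e1 / pow (l1 - d) <= A * k / n%:R.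
  case: hd1 => [r10|hd1].
    by rewrite (M1_1 r10) !mul0r !mulr_ge0.
  apply: (pack_le _ _ r1 (e1 + 2 * d)) => //; first exact: le_trans M1_le.
  by lra.
have J2 : (#|M2|.-1)%:R * q e2 / pow (l2 - d) <= A * k / n%:R.
  case: hd2 => [r20|hd2].
    by rewrite (M2_1 r20) !mul0r !mulr_ge0.
  apply: (pack_le _ _ r2 (e2 + 2 * d)) => //; first exact: le_trans M2_le.
  by lra.
have J0 : (#|{: M1 * M2}|.-1)%:R * (q e0 * q e1 * q e2) / pow (l0 - d) <= A ^+ 2 * k / n%:R.
  rewrite card_prod; case: hd0 => [[r10 r20]|hd0].
    by rewrite (M1_1 r10) (M2_1 r20) !mul0r !mulr_ge0.
  apply: (pack_le _ _ (r1 + r2) (e0 + 2 * d + (e1 + 2 * d) + (e2 + 2 * d))) => //.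
  - by rewrite !mulr_ge0.
  - by rewrite exprn_ge0.
  - apply: le_trans (pred_le _) _; rewrite natrM powD expr2 mulrACA.
    by rewrite ler_pM.
  - rewrite powD powD; apply: ler_pM; rewrite ?mulr_ge0//; exact: ler_pM.
  - by lra.
have K0 := cover_le e0; have K1 := cover_le e1; have K2 := cover_le e2.
have {}H0 := H0 (fun w hw => let: And3 h _ _ := joint_law_pos hPU hP1 hP2 hw in h) ltac:(by move=> f;
  apply: eq_bigr => i _; rewrite !tnth_mktuple).
have {}H1 := H1 (fun w hw => let: And3 _ h _ := joint_law_pos hPU hP1 hP2 hw in h) ltac:(by move=> f;
  rewrite marginal2_XV_tuple; apply: eq_bigr => i _; rewrite !tnth_mktuple).
have {}H2 := H2 (fun w hw => let: And3 _ _ h := joint_law_pos hPU hP1 hP2 hw in h) ltac:(by move=> f;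
  rewrite marginal2_XV_tuple; apply: eq_bigr => i _; rewrite !tnth_mktuple).
have {}G0 := G0 ltac:(by move=> f; apply: eq_bigr => i _; rewrite !tnth_mktuple).
have {}G1 := G1 ltac:(by move=> f; apply: eq_bigr => i _; rewrite !tnth_mktuple).
have {}G2 := G2 ltac:(by move=> f; apply: eq_bigr => i _; rewrite !tnth_mktuple).
have total (x0 x1 x2 y0 y1 y2 k0 k1 k2 j1 j2 j0 b0 b1 b2 c0 c1 c2 m1 m2 m0 i : R) :
    x0 <= b0 * i -> x1 <= b1 * i -> x2 <= b2 * i -> y1 <= c1 * i -> y2 <= c2 * i ->
    y0 <= c0 * i -> k0 <= k * i -> k1 <= k * i -> k2 <= k * i -> j1 <= m1 * i ->
    j2 <= m2 * i -> j0 <= m0 * i ->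
    4 * x0 + 16 * k0 + 2 * (4 * x1 + 16 * k1) + 4 * (4 * x2 + 16 * k2) +
      8 * (y1 + y2 + y0 + (j1 + (j2 + j0))) <=
    (4 * b0 + 16 * k + 2 * (4 * b1 + 16 * k) + 4 * (4 * b2 + 16 * k) +
      8 * (c1 + c2 + c0 + (m1 + (m2 + m0)))) * i by lra.
exact: total H0 H1 H2 G1 G2 G0 K0 K1 K2 J1 J2 J0.
Qed.

End BlockCoding.

(** * The block-Markov code *)

Section BlockMarkov.
Context {R : realType} {X1 X2 S0 S1 S2 Y T1 T2 : finType}.
Variables (PS0 : S0 -> R) (PS1 : S1 -> R) (PS2 : S2 -> R).
Variables (W : X1 -> X2 -> S0 -> S1 -> S2 -> Y -> R).
Hypotheses (hPS0 : is_pmf PS0) (hPS1 : is_pmf PS1) (hPS2 : is_pmf PS2).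
Hypothesis hW : forall x1 x2 s0 s1 s2, is_pmf (W x1 x2 s0 s1 s2).

Variables (l B n N1 N2 : nat) (l_gt0 : (0 < l)%N) (n_ge : (B.+1 * l <= n)%N).
Variables (x10 : X1) (x20 : X2) (s00 : S0) (s10 : S1) (s20 : S2) (y0 : Y).
Variables (w10 : 'I_N1) (w20 : 'I_N2).

(* [msg1 w b.+1] is the part of [w] sent in block [b <= B]; nothing is sent in
   the last block, [b = B]. *)
Variables (msg1 : 'I_N1 -> nat -> T1) (msg2 : 'I_N2 -> nat -> T2) (d1 : T1) (d2 : T2).
Hypotheses (msg1_out : forall w b, ((b == 0) || (B < b))%N -> msg1 w b = d1)
  (msg2_out : forall w b, ((b == 0) || (B < b))%N -> msg2 w b = d2).
Hypotheses (msg1_inj : injective msg1) (msg2_inj : injective msg2).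

Variable bc : @block_code (l.-tuple X1) (l.-tuple X2) (l.-tuple S0) (l.-tuple S1)
  (l.-tuple S2) (l.-tuple Y) T1 T2.

Definition block (T : Type) (x0 : T) (b : nat) (s : seq T) : l.-tuple T :=
  [tuple nth x0 s (b * l + i) | i < l].

Definition msgs w1 w2 b : T1 * T2 := (msg1 w1 b, msg2 w2 b).

Definition block_input1 w1 w2 s0 s1 b : l.-tuple X1 :=
  benc1 bc (msgs w1 w2 b) (msg1 w1 b.+1) (block s00 b s0) (block s10 b s1).
Definition block_input2 w1 w2 s0 s2 b : l.-tuple X2 :=
  benc2 bc (msgs w1 w2 b) (msg2 w2 b.+1) (block s00 b s0) (block s20 b s2).

(** Positions beyond the [B.+1] blocks are filled as well, but no decoding test reads them. *)
Definition input1 w1 w2 s0 s1 j : X1 := nth x10 (block_input1 w1 w2 s0 s1 (j %/ l)) (j %% l).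
Definition input2 w1 w2 s0 s2 j : X2 := nth x20 (block_input2 w1 w2 s0 s2 (j %/ l)) (j %% l).

(** Instead of decoding recursively, encoder 1 searches for a whole message [w2] that explains every
    completed block, the candidate itself supplying the previous pair of each block. *)
Definition consistent1 w1 (s0 : seq S0) j (x2 : seq X2) w2 :=
  [forall b : 'I_B.+1, (b < j %/ l)%N ==>
    (bdec1 bc (msgs w1 w2 b) (block s00 b s0) (block x20 b x2) == msg2 w2 b.+1)].
Definition consistent2 w2 (s0 : seq S0) j (x1 : seq X1) w1 :=
  [forall b : 'I_B.+1, (b < j %/ l)%N ==>
    (bdec2 bc (msgs w1 w2 b) (block s00 b s0) (block x10 b x1) == msg1 w1 b.+1)].
(** Backward decoding as a search: the candidate supplies the pair [b.+1] with which block [b] is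
    decoded. *)
Definition consistent (y : seq Y) (w : 'I_N1 * 'I_N2) :=
  [forall b : 'I_B.+1, bdec bc (msgs w.1 w.2 b.+1) (block y0 b y) == msgs w.1 w.2 b].

Definition block_markov_code : @mac_code X1 X2 S0 S1 S2 Y n N1 N2 := {|
  enc1 := fun j w1 s0 s1 (x2 : j.-tuple X2) =>
    input1 w1 (odflt w20 [pick w2 | consistent1 w1 s0 j x2 w2]) s0 s1 j;
  enc2 := fun j w2 s0 s2 (x1 : j.-tuple X1) =>
    input2 (odflt w10 [pick w1 | consistent2 w2 s0 j x1 w1]) w2 s0 s2 j;
  dec := fun y => odflt (w10, w20) [pick w | consistent y w] |}.

Lemma block_mkseq (T : Type) (x0 : T) (f : nat -> T) (g : nat -> l.-tuple T) j b :
  (forall i, f i = nth x0 (g (i %/ l)%N) (i %% l)%N) -> (b < j %/ l)%N ->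
  block x0 b (mkseq f j) = g b.
Proof.
move=> fE bj; apply: eq_from_tnth => i; rewrite tnth_mktuple nth_mkseq.
  by rewrite fE divnMDl// divn_small// addn0 modnMDl modn_small// -tnth_nth.
rewrite leq_divRL// in bj; apply: leq_trans bj.
by rewrite mulSn addnC ltn_add2r.
Qed.

(** Part 0 is known, and the test of block [b] turns agreement on part [b] into agreement on part
    [b.+1]. The candidate may be wrong on later parts; the current block needs only the parts up to
    [j %/ l]. *)
Lemma consistent1_agree w1 w2 w2' s0 s2 j b :
  (forall b, (b <= B)%N -> bdec1 bc (msgs w1 w2 b) (block s00 b s0)
     (block_input2 w1 w2 s0 s2 b) = msg2 w2 b.+1) ->
  consistent1 w1 s0 j (mkseq (input2 w1 w2 s0 s2) j) w2' ->
  (b <= j %/ l)%N -> msg2 w2' b = msg2 w2 b.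
Proof.
move=> ok /fintype.forallP cons; elim: b => [|b IH] bj; first by rewrite !msg2_out.
have [bB|Bb] := leqP b B; last by rewrite !msg2_out// ltnS ltnW.
have := cons (Ordinal (bB : (b < B.+1)%N)); rewrite /= bj /= => /eqP <-.
rewrite (@block_mkseq _ _ _ (block_input2 w1 w2 s0 s2))//.
by rewrite /msgs IH ?(ltnW bj)// -/(msgs w1 w2 b) ok.
Qed.

Lemma consistent2_agree w1 w1' w2 s0 s1 j b :
  (forall b, (b <= B)%N -> bdec2 bc (msgs w1 w2 b) (block s00 b s0)
     (block_input1 w1 w2 s0 s1 b) = msg1 w1 b.+1) ->
  consistent2 w2 s0 j (mkseq (input1 w1 w2 s0 s1) j) w1' ->
  (b <= j %/ l)%N -> msg1 w1' b = msg1 w1 b.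
Proof.
move=> ok /fintype.forallP cons; elim: b => [|b IH] bj; first by rewrite !msg1_out.
have [bB|Bb] := leqP b B; last by rewrite !msg1_out// ltnS ltnW.
have := cons (Ordinal (bB : (b < B.+1)%N)); rewrite /= bj /= => /eqP <-.
rewrite (@block_mkseq _ _ _ (block_input1 w1 w2 s0 s1))//.
by rewrite /msgs IH ?(ltnW bj)// -/(msgs w1 w2 b) ok.
Qed.

(** Both candidates satisfy the same equations, which determine part [b] from part [b.+1], starting
    from the known part [B.+1]. Correct decoding is not assumed. *)
Lemma consistent_inj y w w' : consistent y w -> consistent y w' -> w = w'.
Proof.
move=> /fintype.forallP cw /fintype.forallP cw'.
have E c : (c <= B.+1)%N -> msgs w.1 w.2 (B.+1 - c) = msgs w'.1 w'.2 (B.+1 - c).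
  elim: c => [_|c IH cB]; first by rewrite /msgs subn0 !msg1_out ?msg2_out ?ltnSn ?orbT.
  have cB' : (B - c < B.+1)%N by rewrite ltnS leq_subr.
  rewrite subSS; have /eqP <- := cw (Ordinal cB'); have /eqP <- := cw' (Ordinal cB').
  by rewrite /= -subSn// IH// ltnW.
have E' b : msgs w.1 w.2 b = msgs w'.1 w'.2 b.
  have [bB|Bb] := leqP b B.+1; first by rewrite -(subKn bB) E// leq_subr.
  by rewrite /msgs !msg1_out ?msg2_out ?(ltnW Bb) ?orbT.
rewrite [w]surjective_pairing [w']surjective_pairing; congr (_, _).
  by apply: msg1_inj; apply/funext => b; have [] := E' b.
by apply: msg2_inj; apply/funext => b; have [] := E' b.
Qed.

(** Stated for the intended inputs, so that it concerns only messages and states; [transmitted_ok]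
    then shows that these inputs are really sent. *)
Definition encoders_ok w1 w2 s0 s1 s2 := forall b, (b <= B)%N ->
  bdec1 bc (msgs w1 w2 b) (block s00 b s0) (block_input2 w1 w2 s0 s2 b) = msg2 w2 b.+1 /\
  bdec2 bc (msgs w1 w2 b) (block s00 b s0) (block_input1 w1 w2 s0 s1 b) = msg1 w1 b.+1.

Lemma transmitted_ok w1 w2 (s0 : n.-tuple S0) (s1 : n.-tuple S1) (s2 : n.-tuple S2) j :
  encoders_ok w1 w2 s0 s1 s2 ->
  let x := transmitted block_markov_code w1 w2 s0 s1 s2 j in
  tval x.1 = mkseq (input1 w1 w2 s0 s1) j /\ tval x.2 = mkseq (input2 w1 w2 s0 s2) j.
Proof.
move=> ok /=; elim: j => [//|j] /=.
case: (transmitted _ _ _ _ _ _ _) => x1 x2 /= [-> ->].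
have ok1 b (h : (b <= B)%N) := (ok b h).1; have ok2 b (h : (b <= B)%N) := (ok b h).2.
rewrite !mkseqS; split; congr (rcons _ _).
  case: pickP => [w2' /(consistent1_agree ok1) agree|/(_ w2)/=]/=.
    by rewrite /input1 /block_input1 /msgs agree.
  move/negbT/negP; case; apply/fintype.forallP => b; apply/implyP => bj.
  rewrite (@block_mkseq _ _ _ (block_input2 w1 w2 s0 s2))// ok1//.
  by rewrite -ltnS.
case: pickP => [w1' /(consistent2_agree ok2) agree|/(_ w1)/=]/=.
  by rewrite /input2 /block_input2 /msgs agree.
move/negbT/negP; case; apply/fintype.forallP => b; apply/implyP => bj.
rewrite (@block_mkseq _ _ _ (block_input1 w1 w2 s0 s1))// ok2//.
by rewrite -ltnS.
Qed.

Lemma dec_ok w1 w2 (y : n.-tuple Y) :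
  (forall b, (b <= B)%N -> bdec bc (msgs w1 w2 b.+1) (block y0 b y) = msgs w1 w2 b) ->
  dec block_markov_code y = (w1, w2).
Proof.
move=> ok /=; have cw : consistent y (w1, w2).
  by apply/fintype.forallP => b; rewrite /= ok// -ltnS.
case: pickP => [w /consistent_inj-/(_ _ cw) //|/(_ (w1, w2))/=]; by rewrite cw.
Qed.

Local Notation failure_in b w1 w2 s0 s1 s2 y :=
  (block_failure bc (msgs w1 w2 b) (msgs w1 w2 b.+1) (block s00 b s0)
     (block_input1 w1 w2 s0 s1 b) (block_input2 w1 w2 s0 s2 b) (block y0 b y)).

Let inputs1 w1 w2 (s0 : n.-tuple S0) (s1 : n.-tuple S1) : n.-tuple X1 :=
  [tuple input1 w1 w2 s0 s1 i | i < n].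
Let inputs2 w1 w2 (s0 : n.-tuple S0) (s2 : n.-tuple S2) : n.-tuple X2 :=
  [tuple input2 w1 w2 s0 s2 i | i < n].

Lemma cond_error_probE (c : @mac_code X1 X2 S0 S1 S2 Y n N1 N2) w1 w2 :
  cond_error_prob PS0 PS1 PS2 W c w1 w2 =
  Ex (iid PS0) (fun s0 => Ex (iid PS1) (fun s1 => Ex (iid PS2) (fun s2 =>
    let x := transmitted c w1 w2 s0 s1 s2 n in
    Ex (channel_tuple W x.1 x.2 s0 s1 s2) (fun y => ⟦ dec c y != (w1, w2) ⟧)))).
Proof.
apply: eq_bigr => s0 _; rewrite mulr_sumr; apply: eq_bigr => s1 _.
rewrite !mulr_sumr; apply: eq_bigr => s2 _; rewrite !mulrA; congr (_ * _).
  by rewrite /state_prob /iid /tprod !big_split.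
case: (transmitted _ _ _ _ _ _ _) => x1 x2 /=.
rewrite big_mkcond; apply: eq_bigr => y _.
by case: (_ != _); rewrite ?mulr1 ?mulr0.
Qed.

(** The union bound is taken under the intended inputs. They differ from the transmitted ones only
    if an encoder misreads a block, an event that does not involve [y] and by itself brings the sum
    of failures to at least 1. *)
Lemma cond_error_prob_le w1 w2 :
  cond_error_prob PS0 PS1 PS2 W block_markov_code w1 w2 <=
  \sum_(b < B.+1) block_error_prob (iid PS0) (iid PS1) (iid PS2)
    (@channel_tuple _ _ _ _ _ _ _ W l) bc (msgs w1 w2 b) (msgs w1 w2 b.+1).
Proof.
have h0 : is_pmf (@iid _ n _ PS0) by exact: tprod_pmf.
have h1 : is_pmf (@iid _ n _ PS1) by exact: tprod_pmf.
have h2 : is_pmf (@iid _ n _ PS2) by exact: tprod_pmf.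
have hw x1 x2 s0 s1 s2 : is_pmf (@channel_tuple _ _ _ _ _ _ _ W n x1 x2 s0 s1 s2).
  exact: tprod_pmf.
rewrite cond_error_probE.
apply: (@le_trans _ _ (Ex (iid PS0) (fun s0 => Ex (iid PS1) (fun s1 => Ex (iid PS2) (fun s2 =>
    Ex (channel_tuple W (inputs1 w1 w2 s0 s1) (inputs2 w1 w2 s0 s2) s0 s1 s2)
      (fun y => \sum_(b < B.+1) ⟦ failure_in b w1 w2 s0 s1 s2 y ⟧)))))).
  apply: Ex_le => // s0; apply: Ex_le => // s1; apply: Ex_le => // s2.
  have sum_ge0 y : 0 <= \sum_(b < B.+1) ⟦ failure_in b w1 w2 s0 s1 s2 y ⟧ :> R.
    exact: sumr_ge0.
  have sum_ge1 y b : (b <= B)%N -> failure_in b w1 w2 s0 s1 s2 y ->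
      1 <= \sum_(b < B.+1) ⟦ failure_in b w1 w2 s0 s1 s2 y ⟧ :> R.
    move=> bB fb; rewrite (bigD1 (Ordinal (bB : (b < B.+1)%N)))//= fb lerDl.
    exact: sumr_ge0.
  have [ok|nok] := pselect (encoders_ok w1 w2 s0 s1 s2).
    have := transmitted_ok n ok; rewrite /=.
    case: (transmitted _ _ _ _ _ _ n) => x1 x2 /= [E1 E2].
    have -> : x1 = inputs1 w1 w2 s0 s1.
      apply: val_inj; rewrite /= E1; apply: (@eq_from_nth _ x10).
        by rewrite size_mkseq size_map size_enum_ord.
      rewrite size_mkseq => i i_n; rewrite nth_mkseq//.
      by rewrite (nth_map (Ordinal i_n)) ?size_enum_ord// nth_enum_ord.
    have -> : x2 = inputs2 w1 w2 s0 s2.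
      apply: val_inj; rewrite /= E2; apply: (@eq_from_nth _ x20).
        by rewrite size_mkseq size_map size_enum_ord.
      rewrite size_mkseq => i i_n; rewrite nth_mkseq//.
      by rewrite (nth_map (Ordinal i_n)) ?size_enum_ord// nth_enum_ord.
    apply: Ex_le => // y; have [_|] := eqVneq; first exact: sum_ge0.
    move=> /eqP wrong; apply: contrapT => nsum; apply: wrong; apply: dec_ok => b bB.
    apply/eqP/negPn/negP => bad; apply: nsum; apply: (sum_ge1 _ b) => //.
    by rewrite /block_failure bad !orbT.
  have [b bB bad] : exists2 b, (b <= B)%N & forall y, failure_in b w1 w2 s0 s1 s2 y.
    apply: contrapT => none; apply: nok => b bB.
    apply: contrapT => /not_andP bad; apply: none; exists b => // y.
    by rewrite /block_failure; case: bad => /eqP ->; rewrite ?orbT.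
  apply: (@le_trans _ _ 1).
    by apply: Ex_le1 => // y; case: (_ != _); rewrite ?ler01.
  rewrite -[leLHS](Ex_cst 1 (hw (inputs1 w1 w2 s0 s1) (inputs2 w1 w2 s0 s2) s0 s1 s2)).
  by apply: Ex_le => // y; apply: (sum_ge1 _ b).
rewrite le_eqVlt; apply/orP; left; apply/eqP.
transitivity (\sum_(b < B.+1) Ex (iid PS0) (fun s0 => Ex (iid PS1) (fun s1 => Ex (iid PS2)
   (fun s2 => Ex (channel_tuple W (inputs1 w1 w2 s0 s1) (inputs2 w1 w2 s0 s2) s0 s1 s2)
      (fun y => ⟦ failure_in b w1 w2 s0 s1 s2 y ⟧))))).
  rewrite -Ex_sum; apply: eq_Ex => s0; rewrite -Ex_sum; apply: eq_Ex => s1.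
  by rewrite -Ex_sum; apply: eq_Ex => s2; rewrite -Ex_sum.
apply: eq_bigr => b _.
have pos_lt (i : 'I_l) : (b * l + i < n)%N.
  apply: leq_trans n_ge; apply: (@leq_trans (b.+1 * l)).
    by rewrite mulSn addnC ltn_add2r.
  by rewrite leq_mul2r ltn_ord orbT.
(* The positions of block [b]. Being distinct, they carry states and outputs with the product laws
   of length [l]. *)
pose h (i : 'I_l) : 'I_n := Ordinal (pos_lt i).
have h_inj : injective h.
  by move=> i j /(congr1 val)/= /eqP; rewrite eqn_add2l => /eqP/val_inj.
have blockE (T : finType) (x0 : T) (t : n.-tuple T) :
    block x0 b t = [tuple tnth t (h i) | i < l].
  by apply: eq_from_tnth => i; rewrite !tnth_mktuple (tnth_nth x0).
have divh (i : 'I_l) : (h i %/ l = b)%N by rewrite /= divnMDl// divn_small// addn0.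
have modh (i : 'I_l) : (h i %% l = i)%N by rewrite /= modnMDl modn_small.
transitivity (Ex (iid PS0) (fun s0 : n.-tuple S0 => Ex (iid PS1) (fun s1 : n.-tuple S1 =>
   Ex (iid PS2) (fun s2 : n.-tuple S2 =>
     let x1 := benc1 bc (msgs w1 w2 b) (msgs w1 w2 b.+1).1
       [tuple tnth s0 (h i) | i < l] [tuple tnth s1 (h i) | i < l] in
     let x2 := benc2 bc (msgs w1 w2 b) (msgs w1 w2 b.+1).2
       [tuple tnth s0 (h i) | i < l] [tuple tnth s2 (h i) | i < l] in
     Ex (channel_tuple W x1 x2 [tuple tnth s0 (h i) | i < l]
       [tuple tnth s1 (h i) | i < l] [tuple tnth s2 (h i) | i < l])
     (fun y => ⟦ block_failure bc (msgs w1 w2 b) (msgs w1 w2 b.+1)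
        [tuple tnth s0 (h i) | i < l] x1 x2 y ⟧))))).
  apply: eq_Ex => s0; apply: eq_Ex => s1; apply: eq_Ex => s2.
  rewrite /block_input1 /block_input2 !blockE /=.
  under eq_Ex => y do rewrite blockE.
  rewrite (Ex_tprod_inj (fun y => ⟦ block_failure bc (msgs w1 w2 b) (msgs w1 w2 b.+1)
        [tuple tnth s0 (h i) | i < l] _ _ y ⟧) _ h_inj)//.
  congr (Ex _ _); apply/funext => y; apply: eq_bigr => i _ /=.
  rewrite !tnth_mktuple /input1 /input2 divh modh.
  by rewrite /block_input1 /block_input2 !blockE -!tnth_nth.
rewrite (Ex_tprod_inj (fun s0 : l.-tuple S0 => Ex (iid PS1) (fun s1 : n.-tuple S1 =>
   Ex (iid PS2) (fun s2 : n.-tuple S2 =>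
     let x1 := benc1 bc (msgs w1 w2 b) (msgs w1 w2 b.+1).1 s0
       [tuple tnth s1 (h i) | i < l] in
     let x2 := benc2 bc (msgs w1 w2 b) (msgs w1 w2 b.+1).2 s0
       [tuple tnth s2 (h i) | i < l] in
     Ex (channel_tuple W x1 x2 s0
       [tuple tnth s1 (h i) | i < l] [tuple tnth s2 (h i) | i < l])
     (fun y => ⟦ block_failure bc (msgs w1 w2 b) (msgs w1 w2 b.+1) s0 x1 x2 y ⟧)))) _ h_inj)//.
apply: eq_Ex => s0.
rewrite (Ex_tprod_inj (fun s1 : l.-tuple S1 =>
   Ex (iid PS2) (fun s2 : n.-tuple S2 =>
     let x1 := benc1 bc (msgs w1 w2 b) (msgs w1 w2 b.+1).1 s0 s1 in
     let x2 := benc2 bc (msgs w1 w2 b) (msgs w1 w2 b.+1).2 s0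
       [tuple tnth s2 (h i) | i < l] in
     Ex (channel_tuple W x1 x2 s0 s1 [tuple tnth s2 (h i) | i < l])
     (fun y => ⟦ block_failure bc (msgs w1 w2 b) (msgs w1 w2 b.+1) s0 x1 x2 y ⟧))) _ h_inj)//.
apply: eq_Ex => s1.
by rewrite (Ex_tprod_inj (fun s2 : l.-tuple S2 =>
     let x1 := benc1 bc (msgs w1 w2 b) (msgs w1 w2 b.+1).1 s0 s1 in
     let x2 := benc2 bc (msgs w1 w2 b) (msgs w1 w2 b.+1).2 s0 s2 in
     Ex (channel_tuple W x1 x2 s0 s1 s2)
     (fun y => ⟦ block_failure bc (msgs w1 w2 b) (msgs w1 w2 b.+1) s0 x1 x2 y ⟧)) _ h_inj).
Qed.

End BlockMarkov.

(** * Single-letter identities *)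

Section Laws.
Context {R : realType} {Om : finType}.
Variables (p : Om -> R) (hp : is_pmf p).

Lemma lawE (T : finType) (F : Om -> T) a : law p F a = Ex p (fun w => ⟦ F w == a ⟧).
Proof.
rewrite /law big_mkcond; apply: eq_bigr => w _.
by case: (_ == _); rewrite ?mulr1 ?mulr0.
Qed.

Lemma law_ge0 (T : finType) (F : Om -> T) a : 0 <= law p F a.
Proof. by apply: sumr_ge0 => w _; case: hp. Qed.

Lemma law_gt0 (T : finType) (F : Om -> T) w : 0 < p w -> 0 < law p F (F w).
Proof.
move=> pw; rewrite /law (bigD1 w)//= ltr_pwDl//.
by apply: sumr_ge0 => v _; case: hp.
Qed.

Lemma Ex_law (T : finType) (F : Om -> T) G : Ex (law p F) G = Ex p (fun w => G (F w)).
Proof.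
rewrite /Ex [RHS](partition_big F predT)//=; apply: eq_bigr => a _.
by rewrite /law mulr_suml; apply: eq_bigr => w /eqP ->.
Qed.


Lemma mutual_infoE (TA TB : finType) (A : Om -> TA) (B : Om -> TB) :
  mutual_info p A B = Ex p (fun w => log2 (law p (fun w => (A w, B w)) (A w, B w) /
    (law p A (A w) * law p B (B w)))).
Proof.
rewrite /mutual_info pair_bigA /=.
rewrite -(Ex_law (fun w => (A w, B w)) (fun ab => log2 (law p (fun w => (A w, B w)) ab /
    (law p A ab.1 * law p B ab.2)))).
by apply: eq_bigr => -[].
Qed.

Lemma cond_mutual_infoE (TA TB TC : finType) (A : Om -> TA) (B : Om -> TB) (C : Om -> TC) :
  cond_mutual_info p A B C = Ex p (fun w =>
    log2 (law p (fun w => (A w, B w, C w)) (A w, B w, C w) * law p C (C w) /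
      (law p (fun w => (A w, C w)) (A w, C w) * law p (fun w => (B w, C w)) (B w, C w)))).
Proof.
rewrite /cond_mutual_info pair_bigA /= pair_bigA /=.
rewrite -(Ex_law (fun w => (A w, B w, C w)) (fun t =>
  log2 (law p (fun w => (A w, B w, C w)) t * law p C t.2 /
      (law p (fun w => (A w, C w)) (t.1.1, t.2) * law p (fun w => (B w, C w)) (t.1.2, t.2))))).
by apply: eq_bigr => -[[]].
Qed.

(** The entropy H(B|C) cancels, leaving H(B|D,C) - H(B|A,C). *)
Lemma cond_mutual_info_diff (TA TB TC TD : finType) (A : Om -> TA) (B : Om -> TB)
    (C : Om -> TC) (D : Om -> TD) :
  cond_mutual_info p A B C - cond_mutual_info p B D C =
  Ex p (fun w => log2 (law p (fun w => (A w, B w, C w)) (A w, B w, C w) /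
    law p (fun w => (A w, C w)) (A w, C w))) -
  Ex p (fun w => log2 (law p (fun w => (B w, D w, C w)) (B w, D w, C w) /
    law p (fun w => (D w, C w)) (D w, C w))).
Proof.
rewrite !cond_mutual_infoE -!ExB; apply: eq_Ex_supp => // w pw.
have HABC := law_gt0 (fun w => (A w, B w, C w)) pw.
have HAC := law_gt0 (fun w => (A w, C w)) pw.
have HBC := law_gt0 (fun w => (B w, C w)) pw.
have HC := law_gt0 C pw.
have HBDC := law_gt0 (fun w => (B w, D w, C w)) pw.
have HDC := law_gt0 (fun w => (D w, C w)) pw.
rewrite !log2_div ?log2M ?mulr_gt0//.
ring.
Qed.

(** When [a] has probability 0 all quotients are 0, which is why this is only an inequality. *)
Lemma sum_cond_law_le1 (T T' : finType) (F : Om -> T) (F' : Om -> T') (I : finType)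
    (k : I -> T) (a : T') : injective k -> (forall i w, F w = k i -> F' w = a) ->
  \sum_i law p F (k i) / law p F' a <= 1.
Proof.
move=> k_inj kF; rewrite -mulr_suml.
have le : \sum_i law p F (k i) <= law p F' a.
  rewrite lawE; under eq_bigr => i _ do rewrite lawE.
  rewrite -Ex_sum; apply: Ex_le => // w.
  have [/existsP[i /eqP Fi]|no] := boolP [exists i, F w == k i].
    rewrite (kF _ _ Fi) eqxx (bigD1 i)//= Fi eqxx big1 ?addr0// => j ji.
    by rewrite (inj_eq k_inj) eq_sym (negPf ji).
  rewrite big1// => i _; case: eqP => // Fi; case/negP: no.
  by apply/existsP; exists i; rewrite Fi.
have [->|nz] := eqVneq (law p F' a) 0; first by rewrite invr0 mulr0.
by rewrite ler_pdivrMr ?mul1r// lt_neqAle eq_sym nz law_ge0.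
Qed.

End Laws.

Section SingleLetter.
Context {R : realType} {X1 X2 S0 S1 S2 Y U V1 V2 : finType}.
Variables (PS0 : S0 -> R) (PS1 : S1 -> R) (PS2 : S2 -> R).
Variables (W : X1 -> X2 -> S0 -> S1 -> S2 -> Y -> R).
Variables (PU : S0 -> U -> R) (P1 : U -> S0 -> S1 -> X1 * V1 -> R).
Variables (P2 : U -> S0 -> S2 -> X2 * V2 -> R).
Hypotheses (hPS0 : is_pmf PS0) (hPS1 : is_pmf PS1) (hPS2 : is_pmf PS2).
Hypothesis hW : forall x1 x2 s0 s1 s2, is_pmf (W x1 x2 s0 s1 s2).
Hypothesis hPU : forall s0, is_pmf (PU s0).
Hypothesis hP1 : forall u s0 s1, is_pmf (P1 u s0 s1).
Hypothesis hP2 : forall u s0 s2, is_pmf (P2 u s0 s2).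

Local Notation P := (joint_law PS0 PS1 PS2 W PU P1 P2).

Let P_pmf : is_pmf P. Proof. exact: joint_law_pmf. Qed.

Let Ex_ind (T : finType) (q : T -> R) (t : T) : Ex q (fun x => ⟦ x == t ⟧) = q t.
Proof.
by rewrite /Ex (bigD1 t)//= eqxx mulr1 big1 ?addr0// => x /negPf ->; rewrite mulr0.
Qed.

Lemma law_V1_S1_US0 u s0 s1 v :
  law P (fun w => (rv_V1 w, rv_S1 w, (rv_U w, rv_S0 w))) (v, s1, (u, s0)) =
  law P (fun w => (rv_S1 w, (rv_U w, rv_S0 w))) (s1, (u, s0)) * marginal2 (P1 u s0 s1) v.
Proof.
rewrite !lawE -ExZr !Ex_joint_law /=.
apply: eq_Ex => s0'; apply: eq_Ex => s1'; apply: eq_Ex => s2'; apply: eq_Ex => u'.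
under eq_Ex => a do rewrite (Ex_from_X2V2 hW hP2).
rewrite (Ex_from_X1V1 hW hP1 hP2) (_ : (s1', (u', s0')) == _ = [&& s1' == s1, u' == u & s0' == s0])//.
have [[-> -> ->]|no] := pselect ([/\ s1' = s1, u' = u & s0' = s0]).
  rewrite !eqxx mul1r -[RHS]Ex_ind -Ex_marginal2; apply: eq_Ex => a.
  by rewrite !xpair_eqE !eqxx !andbT.
have noE b : (b, s1', (u', s0')) == (v, s1, (u, s0)) = false.
  by apply/eqP => -[_ e1 e2 e3]; apply: no.
rewrite [in RHS](_ : [&& _, _ & _] = false) ?mul0r; last first.
  by apply/negP => /and3P[/eqP e1 /eqP e2 /eqP e3]; apply: no.
by under eq_Ex => a do rewrite noE; rewrite Ex_cst.
Qed.

Lemma law_V2_S2_US0 u s0 s2 v :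
  law P (fun w => (rv_V2 w, rv_S2 w, (rv_U w, rv_S0 w))) (v, s2, (u, s0)) =
  law P (fun w => (rv_S2 w, (rv_U w, rv_S0 w))) (s2, (u, s0)) * marginal2 (P2 u s0 s2) v.
Proof.
rewrite !lawE -ExZr !Ex_joint_law /=.
apply: eq_Ex => s0'; apply: eq_Ex => s1'; apply: eq_Ex => s2'; apply: eq_Ex => u'.
rewrite (Ex_from_X1V1 hW hP1 hP2) -[RHS](Ex_cst _ (hP1 u' s0' s1')); apply: eq_Ex => a.
under eq_Ex => b do rewrite Ex_cst//.
rewrite (_ : (s2', (u', s0')) == _ = [&& s2' == s2, u' == u & s0' == s0])//.
have [[-> -> ->]|no] := pselect ([/\ s2' = s2, u' = u & s0' = s0]).
  rewrite !eqxx mul1r -[RHS]Ex_ind -Ex_marginal2; apply: eq_Ex => b.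
  by rewrite !xpair_eqE !eqxx !andbT.
have noE b : (b, s2', (u', s0')) == (v, s2, (u, s0)) = false.
  by apply/eqP => -[_ e1 e2 e3]; apply: no.
rewrite [in RHS](_ : [&& _, _ & _] = false) ?mul0r; last first.
  by apply/negP => /and3P[/eqP e1 /eqP e2 /eqP e3]; apply: no.
by under eq_Ex => b do rewrite noE; rewrite Ex_cst.
Qed.

(** Given the states and [U], the variables [V1] and [V2] are independent; hence H(U,V1,V2|S0,S1,S2)
    splits into the three entropies that govern the codebooks. *)
Lemma law_UV_S u v1 v2 s0 s1 s2 :
  law P (fun w => ((rv_U w, rv_V1 w, rv_V2 w), (rv_S0 w, rv_S1 w, rv_S2 w)))
    ((u, v1, v2), (s0, s1, s2)) =
  law P (fun w => (rv_S0 w, rv_S1 w, rv_S2 w)) (s0, s1, s2) *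
    (PU s0 u * (marginal2 (P1 u s0 s1) v1 * marginal2 (P2 u s0 s2) v2)).
Proof.
rewrite !lawE -ExZr !Ex_joint_law /=.
apply: eq_Ex => s0'; apply: eq_Ex => s1'; apply: eq_Ex => s2'.
under [RHS]eq_Ex => u' do rewrite (Ex_from_X1V1 hW hP1 hP2).
rewrite [RHS]Ex_cst//.
transitivity (Ex (PU s0') (fun u' => ⟦ (s0', s1', s2') == (s0, s1, s2) ⟧ * (⟦ u' == u ⟧ *
  (marginal2 (P1 u' s0' s1') v1 * marginal2 (P2 u' s0' s2') v2)))).
  apply: eq_Ex => u'.
  rewrite -!Ex_ind -!Ex_marginal2 mulrA -!ExZr -ExZ; apply: eq_Ex => a.
  rewrite -!ExZ; apply: eq_Ex => b; rewrite Ex_cst// -!natrM !mulnb.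
  congr (_%:R); congr nat_of_bool; rewrite !xpair_eqE.
  by do ![case: (_ == _)].
rewrite ExZ; have [[-> -> ->]|no] := eqVneq (s0', s1', s2') (s0, s1, s2); last by rewrite !mul0r.
congr (_ * _).
transitivity (Ex (PU s0) (fun u' => ⟦ u' == u ⟧ *
  (marginal2 (P1 u s0 s1) v1 * marginal2 (P2 u s0 s2) v2))).
  by apply: eq_Ex => u'; case: eqP => [->|_] //; rewrite !mul0r.
by rewrite ExZr Ex_ind.
Qed.

Definition score1 u s0 x v : R :=
  law P (fun w => (rv_X1 w, rv_V1 w, (rv_U w, rv_S0 w))) (x, v, (u, s0)) /
  law P (fun w => (rv_X1 w, (rv_U w, rv_S0 w))) (x, (u, s0)).
Definition score2 u s0 x v : R :=
  law P (fun w => (rv_X2 w, rv_V2 w, (rv_U w, rv_S0 w))) (x, v, (u, s0)) /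
  law P (fun w => (rv_X2 w, (rv_U w, rv_S0 w))) (x, (u, s0)).
Definition score0 y (v : U * V1 * V2) : R :=
  law P (fun w => (rv_Y w, (rv_V1 w, rv_V2 w, rv_U w))) (y, (v.1.2, v.2, v.1.1)) /
  law P rv_Y y.

Lemma score1_ge0 u s0 x v : 0 <= score1 u s0 x v.
Proof. by rewrite divr_ge0 ?law_ge0. Qed.
Lemma score2_ge0 u s0 x v : 0 <= score2 u s0 x v.
Proof. by rewrite divr_ge0 ?law_ge0. Qed.
Lemma score0_ge0 y v : 0 <= score0 y v.
Proof. by rewrite divr_ge0 ?law_ge0. Qed.

Lemma score1_le1 u s0 x : \sum_v score1 u s0 x v <= 1.
Proof.
apply: (@sum_cond_law_le1 _ _ _ P_pmf _ _ _ _ _ (fun v => (x, v, (u, s0)))).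
  by move=> v v' [].
by move=> v w [-> _ -> ->].
Qed.
Lemma score2_le1 u s0 x : \sum_v score2 u s0 x v <= 1.
Proof.
apply: (@sum_cond_law_le1 _ _ _ P_pmf _ _ _ _ _ (fun v => (x, v, (u, s0)))).
  by move=> v v' [].
by move=> v w [-> _ -> ->].
Qed.
Lemma score0_le1 y : \sum_v score0 y v <= 1.
Proof.
apply: (@sum_cond_law_le1 _ _ _ P_pmf _ _ _ _ _
  (fun v : U * V1 * V2 => (y, (v.1.2, v.2, v.1.1)))).
  by move=> [[u v1] v2] [[u' v1'] v2'] [/= -> -> ->].
by move=> v w [].
Qed.

Lemma score1_gt0 w : 0 < P w -> 0 < score1 (rv_U w) (rv_S0 w) (rv_X1 w) (rv_V1 w).
Proof.
move=> pw; rewrite divr_gt0//.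
  exact: (law_gt0 P_pmf (fun w => (rv_X1 w, rv_V1 w, (rv_U w, rv_S0 w)))).
exact: (law_gt0 P_pmf (fun w => (rv_X1 w, (rv_U w, rv_S0 w)))).
Qed.
Lemma score2_gt0 w : 0 < P w -> 0 < score2 (rv_U w) (rv_S0 w) (rv_X2 w) (rv_V2 w).
Proof.
move=> pw; rewrite divr_gt0//.
  exact: (law_gt0 P_pmf (fun w => (rv_X2 w, rv_V2 w, (rv_U w, rv_S0 w)))).
exact: (law_gt0 P_pmf (fun w => (rv_X2 w, (rv_U w, rv_S0 w)))).
Qed.
Lemma score0_gt0 w : 0 < P w -> 0 < score0 (rv_Y w) (rv_U w, rv_V1 w, rv_V2 w).
Proof.
move=> pw; rewrite divr_gt0//.
  exact: (law_gt0 P_pmf (fun w => (rv_Y w, (rv_V1 w, rv_V2 w, rv_U w)))).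
exact: (law_gt0 P_pmf rv_Y).
Qed.

Lemma rate1E :
  cond_mutual_info P rv_X1 rv_V1 (fun w => (rv_U w, rv_S0 w)) -
    cond_mutual_info P rv_V1 rv_S1 (fun w => (rv_U w, rv_S0 w)) =
  Ex P (fun w => log2 (score1 (rv_U w) (rv_S0 w) (rv_X1 w) (rv_V1 w))) -
  Ex P (fun w => log2 (marginal2 (P1 (rv_U w) (rv_S0 w) (rv_S1 w)) (rv_V1 w))).
Proof.
rewrite cond_mutual_info_diff//; congr (_ - _); apply: eq_Ex_supp => // w pw.
rewrite law_V1_S1_US0 mulrAC mulfV ?mul1r// lt0r_neq0//.
exact: (law_gt0 P_pmf (fun w => (rv_S1 w, (rv_U w, rv_S0 w)))).
Qed.

Lemma rate2E :
  cond_mutual_info P rv_X2 rv_V2 (fun w => (rv_U w, rv_S0 w)) -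
    cond_mutual_info P rv_V2 rv_S2 (fun w => (rv_U w, rv_S0 w)) =
  Ex P (fun w => log2 (score2 (rv_U w) (rv_S0 w) (rv_X2 w) (rv_V2 w))) -
  Ex P (fun w => log2 (marginal2 (P2 (rv_U w) (rv_S0 w) (rv_S2 w)) (rv_V2 w))).
Proof.
rewrite cond_mutual_info_diff//; congr (_ - _); apply: eq_Ex_supp => // w pw.
rewrite law_V2_S2_US0 mulrAC mulfV ?mul1r// lt0r_neq0//.
exact: (law_gt0 P_pmf (fun w => (rv_S2 w, (rv_U w, rv_S0 w)))).
Qed.

(** The entropy H(U,V1,V2) cancels between the two informations, once the two orderings of the
    triple are identified. *)
Lemma sum_rateE :
  mutual_info P rv_Y (fun w => (rv_V1 w, rv_V2 w, rv_U w)) -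
    mutual_info P (fun w => (rv_U w, rv_V1 w, rv_V2 w))
      (fun w => (rv_S0 w, rv_S1 w, rv_S2 w)) =
  Ex P (fun w => log2 (score0 (rv_Y w) (rv_U w, rv_V1 w, rv_V2 w))) -
  Ex P (fun w => log2 (PU (rv_S0 w) (rv_U w))) -
  Ex P (fun w => log2 (marginal2 (P1 (rv_U w) (rv_S0 w) (rv_S1 w)) (rv_V1 w))) -
  Ex P (fun w => log2 (marginal2 (P2 (rv_U w) (rv_S0 w) (rv_S2 w)) (rv_V2 w))).
Proof.
rewrite !mutual_infoE -!ExB; apply: eq_Ex_supp => // w pw.
have HY := law_gt0 P_pmf rv_Y pw.
have HYV := law_gt0 P_pmf (fun w => (rv_Y w, (rv_V1 w, rv_V2 w, rv_U w))) pw.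
have HV := law_gt0 P_pmf (fun w => (rv_U w, rv_V1 w, rv_V2 w)) pw.
have HS := law_gt0 P_pmf (fun w => (rv_S0 w, rv_S1 w, rv_S2 w)) pw.
have -> : law P (fun w => (rv_V1 w, rv_V2 w, rv_U w)) (rv_V1 w, rv_V2 w, rv_U w) =
    law P (fun w => (rv_U w, rv_V1 w, rv_V2 w)) (rv_U w, rv_V1 w, rv_V2 w).
  rewrite !lawE; apply: eq_Ex => w'; congr (_%:R); congr nat_of_bool.
  by rewrite !xpair_eqE; do ![case: (_ == _)].
rewrite law_UV_S.
have [h0 h1 h2] := joint_law_pos hPU hP1 hP2 pw.
rewrite !log2_div ?log2M ?mulr_gt0//.
ring.
Qed.

End SingleLetter.

(** * Achievability *)

Section Messages.

(** A message is written with [B] digits in ['I_k.+1]. Digits are shifted by one, as part 0 and the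
    parts beyond [B] are padding. *)
Lemma message_blocks (N k B : nat) : (N <= k.+1 ^ B)%N ->
  exists2 msg : 'I_N -> nat -> 'I_k.+1,
    forall w b, ((b == 0) || (B < b))%N -> msg w b = ord0 & injective msg.
Proof.
move=> NkB; have le : (N <= #|{: {ffun 'I_B -> 'I_k.+1}}|)%N by rewrite card_ffun !card_ord.
pose g (w : 'I_N) : {ffun 'I_B -> 'I_k.+1} := enum_val (widen_ord le w).
exists (fun w b => if b is b'.+1 then oapp (g w) ord0 (insub b') else ord0).
  by move=> w [//|b] /=; rewrite ltnS => Bb; rewrite insubF// ltnNge Bb.
move=> w w' E; apply/val_inj; have : g w = g w'.
  by apply/ffunP => i; have := congr1 (fun f => f i.+1) E; rewrite /= valK.
by move/enum_val_inj/(congr1 val).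
Qed.

End Messages.

Section Achievability.
Context {R : realType}.

Lemma nb_messages_gt0 n (r : R) : 0 <= r -> (0 < nb_messages n r)%N.
Proof.
move=> r0; rewrite /nb_messages; rewrite truncn_ge_nat ?powR_ge0//.
by rewrite -[leLHS]/(1 : R) -[leLHS](powRr0 2) ler_powR ?ler1n ?mulr_ge0.
Qed.

Lemma nb_messages_le n (r : R) : (nb_messages n r)%:R <= 2 `^ (n%:R * r) :> R.
Proof. by rewrite /nb_messages truncn_le. Qed.

(** The [n * r] bits are spread over [B] blocks of length about [n / (B + 1)], whence the rate
    [r * (B + 1) / B]. The factor 2 pays for rounding up the number of digits, the next one for
    rounding down the block length. *)
Lemma block_messages n B (r : R) : 0 <= r -> (0 < B)%N ->
  exists k : nat, [/\ (nb_messages n r <= k.+1 ^ B)%N, r = 0 -> k = 0%N &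
    k.+1%:R <= 2 * 2 `^ (r * B.+1%:R / B%:R) * 2 `^ ((n %/ B.+1)%:R * (r * B.+1%:R / B%:R))].
Proof.
move=> r0 B0; set r' := r * _ / _; set l := (n %/ _)%N.
have B0' : B%:R != 0 :> R by rewrite pnatr_eq0 -lt0n.
have r'0 : 0 <= r' by rewrite divr_ge0 ?mulr_ge0.
have pow_ge1 x : 0 <= x -> 1 <= 2 `^ x :> R.
  by move=> x0; rewrite -[leLHS](powRr0 2) ler_powR ?ler1n.
have [r_eq0|r_neq0] := eqVneq r 0.
  exists 0%N; split=> //.
    rewrite exp1n -(@ler_nat R); apply: le_trans (nb_messages_le _ _) _.
    by rewrite r_eq0 mulr0 powRr0.
  have h1 := pow_ge1 _ r'0; have h2 := pow_ge1 (l%:R * r') (mulr_ge0 (ler0n _ _) r'0).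
  apply: (@le_trans _ _ (2 * 1 * 1)); first by rewrite !mulr1 ler_nat.
  by rewrite ler_pM// ler_pM.
exists (Num.truncn (2 `^ (n%:R * r / B%:R) : R)); split=> [|r0'|].
- rewrite -(@ler_nat R); apply: le_trans (nb_messages_le _ _) _.
  rewrite natrX; apply: (@le_trans _ _ ((2 `^ (n%:R * r / B%:R)) ^+ B)).
    by rewrite -powR_mulrn ?powR_ge0// -powRrM mulfVK.
  rewrite lerXn2r ?nnegrE ?powR_ge0// ltW// truncnS_gt//.
- by rewrite r0' eqxx in r_neq0.
have nr : 0 <= n%:R * r / B%:R by rewrite divr_ge0 ?mulr_ge0.
apply: (@le_trans _ _ (2 * 2 `^ (n%:R * r / B%:R))).
  rewrite -natr1 mulrDl mul1r lerD ?pow_ge1//.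
  by rewrite truncn_le// powR_ge0.
rewrite -[leRHS]mulrA -powRD; last by rewrite pnatr_eq0 implybT.
rewrite ler_wpM2l// ler_powR ?ler1n//.
have -> : r' + l%:R * r' = (B.+1 * l.+1)%:R * r / B%:R.
  by rewrite /r' natrM -(natr1 l); field.
rewrite ler_wpM2r ?invr_ge0// ler_wpM2r// ler_nat ltnW//.
by rewrite mulnC ltn_ceil.
Qed.

Lemma law_pmf (Om T : finType) (p : Om -> R) (F : Om -> T) : is_pmf p -> is_pmf (law p F).
Proof.
move=> hp; split=> [a|]; first exact: law_ge0.
rewrite -(Ex_cst 1 hp) -(Ex_law p F (fun=> 1)).
by apply: eq_bigr => a _; rewrite mulr1.
Qed.

Lemma uniform_pmf (T : finType) : (0 < #|T|)%N -> is_pmf (fun _ : T => #|T|%:R^-1 : R).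
Proof.
move=> T0; split=> [t|]; first by rewrite invr_ge0.
by rewrite sumr_const -[LHS]mulr_natl mulfV// pnatr_eq0 -lt0n.
Qed.

Variables (X1 X2 S0 S1 S2 Y : finType).
Variables (PS0 : S0 -> R) (PS1 : S1 -> R) (PS2 : S2 -> R).
Variables (W : X1 -> X2 -> S0 -> S1 -> S2 -> Y -> R).
Hypotheses (hPS0 : is_pmf PS0) (hPS1 : is_pmf PS1) (hPS2 : is_pmf PS2).
Hypothesis hW : forall x1 x2 s0 s1 s2, is_pmf (W x1 x2 s0 s1 s2).

Lemma avg_error_prob_ge0 n M1 M2 (c : @mac_code X1 X2 S0 S1 S2 Y n M1 M2) :
  0 <= avg_error_prob PS0 PS1 PS2 W c.
Proof.
rewrite mulr_ge0 ?invr_ge0//; apply: sumr_ge0 => w1 _; apply: sumr_ge0 => w2 _.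
rewrite cond_error_probE.
by do 3 (apply: Ex_ge0 => [|?]; first exact: tprod_pmf); apply: Ex_ge0 => //; exact: tprod_pmf.
Qed.

(** A single sequence of codes is required, while the hypothesis gives codes depending on [e]: for
    each [n] a code within [1 / (n + 1)] of the infimum serves all [e]. The symbols [x10] and [x20]
    show that some code exists. *)
Lemma achievable_of_vanishing (x10 : X1) (x20 : X2) (r : R * R) : 0 <= r.1 -> 0 <= r.2 ->
  (forall e, 0 < e -> exists N, forall n, (N <= n)%N ->
    exists c : @mac_code X1 X2 S0 S1 S2 Y n (nb_messages n r.1) (nb_messages n r.2),
      avg_error_prob PS0 PS1 PS2 W c <= e) ->
  achievable PS0 PS1 PS2 W r.
Proof.
move=> r1 r2 vanish.
have best n : exists c : @mac_code X1 X2 S0 S1 S2 Y n (nb_messages n r.1) (nb_messages n r.2),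
    forall c' : @mac_code X1 X2 S0 S1 S2 Y n (nb_messages n r.1) (nb_messages n r.2),
      avg_error_prob PS0 PS1 PS2 W c <= avg_error_prob PS0 PS1 PS2 W c' + n.+1%:R^-1.
  pose E := range (fun c : @mac_code X1 X2 S0 S1 S2 Y n (nb_messages n r.1) (nb_messages n r.2) =>
    avg_error_prob PS0 PS1 PS2 W c).
  pose w0 := (Ordinal (nb_messages_gt0 n r1), Ordinal (nb_messages_gt0 n r2)).
  pose c0 : @mac_code X1 X2 S0 S1 S2 Y n (nb_messages n r.1) (nb_messages n r.2) :=
    {| enc1 := fun _ _ _ _ _ => x10; enc2 := fun _ _ _ _ _ => x20; dec := fun=> w0 |}.
  have lbE : lbound E 0 by move=> _ [c _ <-]; exact: avg_error_prob_ge0.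
  have hE : has_inf E by split; [exists (avg_error_prob PS0 PS1 PS2 W c0); exists c0|exists 0].
  have n0 : 0 < n.+1%:R^-1 :> R by rewrite invr_gt0 ltr0n.
  have [_ [c _ <-] hc] := inf_adherent n0 hE.
  exists c => c'; apply: le_trans (ltW hc) _; rewrite lerD2r.
  by apply: ge_inf; [exists 0|exists c'].
split=> //; pose c n := projT1 (cid (best n)); have hc n := projT2 (cid (best n)); exists c.
apply/cvgrPdist_le => e e0.
have e2 : 0 < e / 2 by rewrite divr_gt0.
have [N hN] := vanish _ e2.
near=> n; rewrite sub0r normrN ger0_norm ?avg_error_prob_ge0//.
have [|c' hc'] := hN n; first by near: n; exists N.
apply: le_trans (hc n c') _; rewrite [leRHS]splitr lerD//.
near: n; exists (Num.truncn ((e / 2)^-1)) => // n /= hn.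
rewrite -[leRHS]invrK lef_pV2 ?posrE ?invr_gt0//.
apply: le_trans (ltW (truncnS_gt _)) _; by rewrite ler_nat ltnS.
Unshelve. all: by end_near.
Qed.

Lemma rates_achievable (U V1 V2 : finType) (PU : S0 -> U -> R)
    (P1 : U -> S0 -> S1 -> X1 * V1 -> R) (P2 : U -> S0 -> S2 -> X2 * V2 -> R)
    (r : R * R) :
  (forall s0, is_pmf (PU s0)) -> (forall u s0 s1, is_pmf (P1 u s0 s1)) ->
  (forall u s0 s2, is_pmf (P2 u s0 s2)) -> 0 <= r.1 -> 0 <= r.2 ->
  let P := joint_law PS0 PS1 PS2 W PU P1 P2 in
  let US0 w := (rv_U w, rv_S0 w) in
  r.1 = 0 \/ r.1 < cond_mutual_info P rv_X1 rv_V1 US0 - cond_mutual_info P rv_V1 rv_S1 US0 ->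
  r.2 = 0 \/ r.2 < cond_mutual_info P rv_X2 rv_V2 US0 - cond_mutual_info P rv_V2 rv_S2 US0 ->
  (r.1 = 0 /\ r.2 = 0) \/ r.1 + r.2 <
    mutual_info P rv_Y (fun w => (rv_V1 w, rv_V2 w, rv_U w)) -
    mutual_info P (fun w => (rv_U w, rv_V1 w, rv_V2 w)) (fun w => (rv_S0 w, rv_S1 w, rv_S2 w)) ->
  achievable PS0 PS1 PS2 W r.
Proof.
move=> hPU hP1 hP2 r1_ge0 r2_ge0 P US0.
rewrite rate1E// rate2E// sum_rateE// => h1 h2 h0.
have s00 := pmf_witness hPS0; have s10 := pmf_witness hPS1; have s20 := pmf_witness hPS2.
have u0 := pmf_witness (hPU s00).
have [x10 _] := pmf_witness (hP1 u0 s00 s10).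
have [x20 _] := pmf_witness (hP2 u0 s00 s20).
have y0 := pmf_witness (hW x10 x20 s00 s10 s20).
(* The condition [x * (B + 1) / B < y] amounts to [x / (y - x) < B]. *)
have slack (Q : Prop) (x y : R) : 0 <= x -> Q \/ x < y ->
    exists B0, forall B, (B0 < B)%N -> Q \/ x * B.+1%:R / B%:R < y.
  move=> x0 [hQ|xy]; first by exists 0%N; left.
  exists (Num.truncn (x / (y - x))) => B hB; right.
  have B0 : 0 < B%:R :> R by rewrite ltr0n (leq_ltn_trans _ hB).
  rewrite ltr_pdivrMr// -natr1 mulrDr mulr1 -ltrBrDl -mulrBl.
  rewrite mulrC -ltr_pdivrMr ?subr_gt0//; apply: lt_le_trans (truncnS_gt _) _.
  by rewrite ler_nat.
have [B1 hB1] := slack _ _ _ r1_ge0 h1.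
have [B2 hB2] := slack _ _ _ r2_ge0 h2.
have [B0 hB0] := slack _ _ _ (addr_ge0 r1_ge0 r2_ge0) h0.
pose B := (B1 + B2 + B0).+1.
have {}hB1 := hB1 B ltac:(by rewrite ltnS -addnA leq_addr).
have {}hB2 := hB2 B ltac:(by rewrite ltnS addnAC leq_addl).
have {}hB0 := hB0 B ltac:(by rewrite ltnS leq_addl).
pose r1 := r.1 * B.+1%:R / B%:R; pose r2 := r.2 * B.+1%:R / B%:R.
have pow_ge1 x : 0 <= x -> 1 <= 2 `^ x :> R.
  by move=> x0; rewrite -[leLHS](powRr0 2) ler_powR ?ler1n.
have Bq0 : B.+1%:R / B%:R != 0 :> R by rewrite mulf_neq0 ?invr_neq0 ?pnatr_eq0.
have r1'_ge0 : 0 <= r1 by rewrite divr_ge0 ?mulr_ge0.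
have r2'_ge0 : 0 <= r2 by rewrite divr_ge0 ?mulr_ge0.
have r1_eq0 : r1 = 0 -> r.1 = 0.
  by rewrite /r1 -mulrA => /eqP; rewrite mulf_eq0 (negPf Bq0) orbF => /eqP.
have r2_eq0 : r2 = 0 -> r.2 = 0.
  by rewrite /r2 -mulrA => /eqP; rewrite mulf_eq0 (negPf Bq0) orbF => /eqP.
pose A : R := 2 * 2 `^ r1 * 2 `^ r2.
have A_ge0 : 0 <= A by rewrite !mulr_ge0 ?powR_ge0.
have [D hD] : exists D : R, forall (n : nat) (M1 M2 : finType) (c : (M1 * M2) * (M1 * M2) -> R),
    (0 < n)%N -> is_pmf c ->
    (r1 = 0 -> #|M1| = 1%N) -> (r2 = 0 -> #|M2| = 1%N) ->
    #|M1|%:R <= A * 2 `^ (n%:R * r1) -> #|M2|%:R <= A * 2 `^ (n%:R * r2) ->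
    exists b, Ex c (fun km => block_error_prob (@iid _ n _ PS0) (@iid _ n _ PS1) (@iid _ n _ PS2)
      (@channel_tuple _ _ _ _ _ _ _ W n) b km.1 km.2) <= D / n%:R.
  apply: (block_coding hPS0 hPS1 hPS2 hW hPU hP1 hP2
    (@score0_ge0 _ _ _ _ _ _ _ _ _ _ _ _ _ _ _ _ _ hPS0 hPS1 hPS2 hW hPU hP1 hP2)
    (score0_le1 hPS0 hPS1 hPS2 hW hPU hP1 hP2)
    (score1_ge0 hPS0 hPS1 hPS2 hW hPU hP1 hP2) (score1_le1 hPS0 hPS1 hPS2 hW hPU hP1 hP2)
    (score2_ge0 hPS0 hPS1 hPS2 hW hPU hP1 hP2) (score2_le1 hPS0 hPS1 hPS2 hW hPU hP1 hP2)
    (score0_gt0 hPS0 hPS1 hPS2 hW hPU hP1 hP2) (score1_gt0 hPS0 hPS1 hPS2 hW hPU hP1 hP2)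
    (score2_gt0 hPS0 hPS1 hPS2 hW hPU hP1 hP2) r1'_ge0 r2'_ge0 A_ge0).
  - by case: hB1 => [h|]; [left; rewrite /r1 h !mul0r|right].
  - by case: hB2 => [h|]; [left; rewrite /r2 h !mul0r|right].
  - case: hB0 => [[e1 e2]|]; [left; by rewrite /r1 /r2 e1 e2 !mul0r|right].
    by rewrite /r1 /r2 -!mulrDl.
apply: (achievable_of_vanishing x10 x20) => // e e_gt0.
(* Makes [l] exceed [B.+1 * D / e], so that the total over the blocks, [B.+1 * D / l], is at most
   [e]. *)
exists ((Num.truncn (B.+1%:R * D / e)).+1 * B.+1)%N => n n_ge.
pose l := (n %/ B.+1)%N.
have l_ge : (Num.truncn (B.+1%:R * D / e) < l)%N by rewrite /l leq_divRL.
have l_gt0 : (0 < l)%N by exact: leq_ltn_trans l_ge.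
have [k1 [N1_le k1_0 k1_le]] := @block_messages n B r.1 r1_ge0 isT.
have [k2 [N2_le k2_0 k2_le]] := @block_messages n B r.2 r2_ge0 isT.
have [msg1 out1 inj1] := message_blocks N1_le.
have [msg2 out2 inj2] := message_blocks N2_le.
have N1_gt0 := nb_messages_gt0 n r1_ge0; have N2_gt0 := nb_messages_gt0 n r2_ge0.
set N1 := nb_messages n r.1 in msg1 out1 inj1 N1_gt0 *.
set N2 := nb_messages n r.2 in msg2 out2 inj2 N2_gt0 *.
(* One block code serves all blocks, so it is chosen good on average over uniform messages and a
   uniform block index; multiplied by [B.+1], this average becomes the sum over blocks. *)
pose I : finType := ('I_N1 * 'I_N2 * 'I_B.+1)%type.
have I_gt0 : (0 < #|I|)%N by rewrite !card_prod !card_ord !muln_gt0 N1_gt0 N2_gt0.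
have hu := uniform_pmf I_gt0.
pose km (t : I) := (msgs msg1 msg2 t.1.1 t.1.2 t.2, msgs msg1 msg2 t.1.1 t.1.2 t.2.+1).
have A1 : 2 * 2 `^ r1 <= A by rewrite ler_peMr ?mulr_ge0 ?powR_ge0// pow_ge1.
have A2 : 2 * 2 `^ r2 <= A.
  by rewrite /A mulrAC ler_peMr ?mulr_ge0 ?powR_ge0// pow_ge1.
have k1_le' : #|'I_k1.+1|%:R <= A * 2 `^ (l%:R * r1).
  by rewrite card_ord; apply: le_trans k1_le _; apply: ler_wpM2r; rewrite ?powR_ge0.
have k2_le' : #|'I_k2.+1|%:R <= A * 2 `^ (l%:R * r2).
  by rewrite card_ord; apply: le_trans k2_le _; apply: ler_wpM2r; rewrite ?powR_ge0.
have [bc hbc] := hD l _ _ _ l_gt0 (law_pmf km hu)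
  (fun h => etrans (card_ord _) (congr1 S (k1_0 (r1_eq0 h))))
  (fun h => etrans (card_ord _) (congr1 S (k2_0 (r2_eq0 h)))) k1_le' k2_le'.
have n_ge' : (B.+1 * l <= n)%N by rewrite mulnC leq_trunc_div.
pose c := block_markov_code B n x10 x20 s00 s10 s20 y0 (Ordinal N1_gt0) (Ordinal N2_gt0)
  msg1 msg2 bc.
exists c; apply: (@le_trans _ _ (B.+1%:R * (D / l%:R))); last first.
  rewrite mulrA ler_pdivrMr ?ltr0n// [leRHS]mulrC -ler_pdivrMr//.
  by apply: le_trans (ltW (truncnS_gt _)) _; rewrite ler_nat.
rewrite Ex_law in hbc.
apply: le_trans (ler_wpM2l (ler0n _ B.+1) hbc).
rewrite /avg_error_prob /Ex -mulr_sumr mulrA.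
have -> : B.+1%:R * #|I|%:R^-1 = (N1 * N2)%:R^-1 :> R.
  rewrite !card_prod !card_ord [in LHS]natrM invfM mulrCA mulfV ?mulr1//.
rewrite ler_wpM2l ?invr_ge0//.
rewrite -(pair_bigA _ (fun w b => block_error_prob (iid PS0) (iid PS1) (iid PS2)
  (@channel_tuple _ _ _ _ _ _ _ W l) bc (km (w, b)).1 (km (w, b)).2))/=.
rewrite -(pair_bigA _ (fun w1 w2 => \sum_(b < B.+1) block_error_prob (iid PS0) (iid PS1) (iid PS2)
  (@channel_tuple _ _ _ _ _ _ _ W l) bc (km (w1, w2, b)).1 (km (w1, w2, b)).2))/=.
apply: ler_sum => w1 _; apply: ler_sum => w2 _.
exact: (cond_error_prob_le hPS0 hPS1 hPS2 hW l_gt0 n_ge' _ _ _ _ _ _ _ _ out1 out2 inj1 inj2).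
Qed.

End Achievability.

Theorem theorem2 (R : realType) (X1 X2 S0 S1 S2 Y : finType)
  (PS0 : S0 -> R) (PS1 : S1 -> R) (PS2 : S2 -> R)
  (W : X1 -> X2 -> S0 -> S1 -> S2 -> Y -> R)
  (hPS0 : is_pmf PS0) (hPS1 : is_pmf PS1) (hPS2 : is_pmf PS2)
  (hW : forall x1 x2 s0 s1 s2, is_pmf (W x1 x2 s0 s1 s2)) :
  rate_region PS0 PS1 PS2 W `<=` capacity_region PS0 PS1 PS2 W.
Proof.
move=> r [r1 r2 [U [V1 [V2 [PU [P1 [P2 [hPU hP1 hP2 [h1 h2 h0]]]]]]]]].
move=> N /nbhs_ballP[e /= e0 eN].
have e2 : 0 < e / 2 by rewrite divr_gt0.
(* A lowered rate stays nonnegative and is either 0 or strictly smaller, matching the alternatives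
   of [rates_achievable]. *)
pose lower (x : R) := Num.max 0 (x - e / 2).
have lower0 x : 0 <= lower x by rewrite le_max lexx.
have lower_lt x : 0 <= x -> lower x = 0 \/ lower x < x.
  move=> x0; rewrite /lower; case: (leP 0 (x - e / 2)) => h; [right|by left].
  by rewrite gtrBl.
have lower_le x : 0 <= x -> lower x <= x.
  by move=> x0; rewrite ge_max x0 gerBl ltW.
have lower_ball (x : R) : 0 <= x -> ball (x : R) e (lower x).
  move=> x0; rewrite /ball /= ger0_norm ?subr_ge0 ?lower_le//.
  rewrite ltrBlDr -ltrBlDl lt_max; apply/orP; right.
  by rewrite ltrD2l ltrN2 gtr_pMr// invf_lt1 ?ltr1n.
exists (lower r.1, lower r.2); split; last first.
  by apply: eN; split => /=; exact: lower_ball.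
apply: (@rates_achievable R X1 X2 S0 S1 S2 Y PS0 PS1 PS2 W hPS0 hPS1 hPS2 hW
  U V1 V2 PU P1 P2) => //=.
- by case: (lower_lt _ r1) => [->|lt]; [left|right; exact: lt_le_trans h1].
- by case: (lower_lt _ r2) => [->|lt]; [left|right; exact: lt_le_trans h2].
- have l1 := lower_le _ r1; have l2 := lower_le _ r2.
  (* One strictly lowered rate makes the sum strict; otherwise both lowered rates are 0. *)
  case: (lower_lt _ r1) => [z1|lt1]; last first.
    by right; apply: lt_le_trans h0; rewrite ltr_leD.
  case: (lower_lt _ r2) => [z2|lt2]; first by left.
  by right; apply: lt_le_trans h0; rewrite ler_ltD.
Qed.
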